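(* Let $L$ be a finite set of even cardinality. Then $I_L^{(2)}\otimes_{\mathbb{Z}}\mathbb{Z}[\tfrac{1}{12!}]$ is spanned as a $\mathbb{Z}[\tfrac{1}{12!}]$-module by the simple binomial relations.
   Context: Let $L$ be a finite nonempty set of even cardinality. Consider directed graphs with vertex set $L$, loops and multiple edges allowed. A graph is regular of degree $k$ if every vertex has valence $k$ (a loop contributes $2$ to the valence). Regular graphs form a semigroup $\mathcal{G}$: $\Gamma\cdot\Gamma'$ is the graph on $L$ whose edge set is the disjoint union of those of $\Gamma$ and $\Gamma'$. Write $X_\Gamma$ for the element of the semigroup algebra $\mathbb{Z}[\mathcal{G}]$ corresponding to $\Gamma$. The ring $R_L$ is the quotient of $\mathbb{Z}[\mathcal{G}]$ by the relations: (1) Loop relation: $X_\Gamma=0$ if $\Gamma$ has a loop. (2) Sign relation: $X_\Gamma=-X_{\Gamma'}$ if $\Gamma'$ is obtained from $\Gamma$ by reversing the direction of one edge. (3) Plücker relation: if $\overrightarrow{ab}$ and $\overrightarrow{cd}$ are two edges of $\Gamma$, and $\Gamma'$ (resp. $\Gamma''$) is obtained from $\Gamma$ by replacing them with $\overrightarrow{ad},\overrightarrow{cb}$ (resp. $\overrightarrow{ac},\overrightarrow{bd}$), then $X_\Gamma=X_{\Gamma'}+X_{\Gamma''}$. The image of $X_\Gamma$ in $R_L$ is still written $X_\Gamma$; $R_L^{(k)}$ is the $\mathbb{Z}$-span of the $X_\Gamma$ with $\Gamma$ regular of degree $k$. A matching is a regular graph of degree one. Put $V_L=R_L^{(1)}$,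 spanned by the $X_\Gamma$ with $\Gamma$ a matching; $V_L$ generates $R_L$ (Kempe). The ideal of relations $I_L$ is the kernel of the surjection $\operatorname{Sym}(V_L)\to R_L$; $I_L^{(2)}\subset\operatorname{Sym}^2(V_L)$ is its degree-two part. Simple binomial relations: let $U\subset L$ have cardinality $4$, $L'=L\setminus U$, let $\Delta,\Delta'$ be matchings on $U$ and $\Gamma,\Gamma'$ matchings on $L'$ (empty if $L'=\emptyset$). Writing $\Gamma\Delta$ for the matching on $L$ that is the union of $\Gamma$ and $\Delta$ (and similarly for the others), the associated simple binomial relation is $X_{\Gamma\Delta}X_{\Gamma'\Delta'}-X_{\Gamma\Delta'}X_{\Gamma'\Delta}\in I_L^{(2)}$. *)

(* Defs.v *)
From HB Require Import structures.
From mathcomp Require Import all_boot all_order all_algebra.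
From mathcomp Require Import finmap boolp.
From mathcomp Require Import monalg.

Set Implicit Arguments.
Unset Strict Implicit.
Unset Printing Implicit Defensive.

Import GRing.Theory.

Local Open Scope ring_scope.
Local Open Scope quotient_scope.

(* Finite combinations  \sum_i act a_i x_i  with all the x_i in S.  The action
   is  *%R  for ideals,  x *~ n  for abelian groups,  *:%R  for modules. *)
Definition lin_span (A : choiceType) (M : zmodType) (act : A -> M -> M)
    (S : M -> Prop) (x : M) : Prop :=
  exists s : seq (A * M),
    (forall p, p \in s -> S p.2) /\ x = \sum_(p <- s) act p.1 p.2.

Section Span.
Context (A : pzRingType) (M : zmodType) (act : A -> M -> M) (S : M -> Prop).

Lemma lin_span0 : lin_span act S 0.
Proof. by exists [::]; rewrite big_nil. Qed.

Lemma lin_spanD x y : lin_span act S x -> lin_span act S y -> lin_span act S (x + y).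
Proof.
move=> [s [Ss ->]] [t [St ->]]; exists (s ++ t); rewrite big_cat; split=> // p.
by rewrite mem_cat => /orP[/Ss|/St].
Qed.

Lemma lin_span_map (f : M -> M) (g : A -> A) x :
    f 0 = 0 -> {morph f : u v / u + v} ->
    (forall a u, f (act a u) = act (g a) u) ->
  lin_span act S x -> lin_span act S (f x).
Proof.
move=> f0 fD fact [s [Ss ->]]; exists [seq (g p.1, p.2) | p <- s]; split.
  by move=> p /mapP[q /Ss Sq ->].
rewrite big_map (big_morph f fD f0).
by apply: eq_bigr => p _; rewrite fact.
Qed.

Lemma lin_span_gen a x : S x -> lin_span act S (act a x).
Proof.
move=> Sx; exists [:: (a, x)]; rewrite big_seq1; split=> // p.
by rewrite inE => /eqP->.
Qed.

End Span.

Definition zspan (M : zmodType) (S : M -> Prop) : pred M :=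
  fun x => `[< lin_span (fun (n : int) y => y *~ n) S x >].

Lemma zspan_zmod_closed (M : zmodType) (S : M -> Prop) : zmod_closed (zspan S).
Proof.
split=> [|x y /asboolP Sx /asboolP Sy]; apply/asboolP; first exact: lin_span0.
apply: lin_spanD => //; apply: (@lin_span_map _ _ _ _ -%R -%R) => //.
- exact: oppr0.
- exact: opprD.
- by move=> a u; rewrite mulrNz.
Qed.

HB.instance Definition _ (M : zmodType) (S : M -> Prop) :=
  GRing.isZmodClosed.Build M (zspan S) (zspan_zmod_closed S).

Lemma zspan_gen (M : zmodType) (S : M -> Prop) x : S x -> x \in zspan S.
Proof.
by move=> Sx; apply/asboolP; have := lin_span_gen (fun (n : int) y => y *~ n) 1 Sx.
Qed.

Lemma zspan_ker (M N : zmodType) (f : {additive M -> N}) (S : M -> Prop) :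
  (forall x, S x -> f x = 0) -> forall x, x \in zspan S -> f x = 0.
Proof.
move=> f0 x /asboolP[s [Ss ->]]; rewrite raddf_sum big_seq big1 // => p /Ss Sp.
by rewrite raddfMz (f0 _ Sp) mul0rz.
Qed.

Definition ideal_gen (R : comNzRingType) (S : R -> Prop) : pred R :=
  fun x => `[< lin_span *%R S x >].

Lemma ideal_gen_ker (R S : comNzRingType) (f : {rmorphism R -> S})
    (T : R -> Prop) :
  (forall x, T x -> f x = 0) -> forall x, x \in ideal_gen T -> f x = 0.
Proof.
move=> f0 x /asboolP[s [Ts ->]]; rewrite rmorph_sum big_seq big1 // => p /Ts Tp.
by rewrite rmorphM (f0 _ Tp) mulr0.
Qed.

Lemma ideal_gen_gen (R : comNzRingType) (S : R -> Prop) x :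
  S x -> x \in ideal_gen S.
Proof.
by move=> Sx; apply/asboolP; have := lin_span_gen *%R 1 Sx; rewrite mul1r.
Qed.

(* Quotients by idealr are nonzero rings; every generator used below has
   constant coefficient 0, so 1 is not in the ideal. *)
Lemma ideal_gen_malg (K : conomType) (S : {malg int[K]} -> Prop) :
  (forall x, S x -> x@_mone = 0) -> idealr_closed (ideal_gen S).
Proof.
move=> S0; split=> [||a x y /asboolP Sx /asboolP Sy].
- by apply/asboolP; apply: lin_span0.
- apply/negP => /(@ideal_gen_ker _ _ (@mcoeff K int mone) _ S0).
  by rewrite rmorph1 => /eqP; rewrite oner_eq0.
- apply/asboolP; apply: lin_spanD => //.
  apply: (@lin_span_map _ _ _ _ ( *%R a) ( *%R a)) => //.
  + exact: mulr0.
  + by move=> u v; rewrite mulrDr.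
  + by move=> b u; rewrite mulrA.
Qed.

(* Locked: unification otherwise tries to compute the finitely supported
   functions representing these elements. *)
HB.lock Definition indet (V : choiceType) (v : V) : {malg int[{cmonom V}]} :=
  << ucm v >>.

Section SymmetricAlgebra.
Context (V : zmodType).

Local Notation free_comring := {malg int[{cmonom V}]}.

Definition sym_relation (x : free_comring) : Prop :=
  exists u v : V, x = indet (u + v) - indet u - indet v.

Definition sym_ideal : pred free_comring := ideal_gen sym_relation.

Lemma sym_relation0 x : sym_relation x -> x@_mone = 0.
Proof.
have E (w : V) : (indet w)@_mone = 0.
  by rewrite indet.unlock mcoeffU cm1_eq1 mulr0n.
by case=> u [v ->]; rewrite 2!mcoeffB !E !subr0.
Qed.

HB.instance Definition _ :=
  isIdealr.Build free_comring sym_ideal (ideal_gen_malg sym_relation0).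

Definition Sym := {ideal_quot (sym_ideal : idealr free_comring)}.
HB.instance Definition _ := GRing.ComNzRing.on Sym.

Definition sym_gen (v : V) : Sym := \pi_Sym (indet v).

Definition sym_degree (n : nat) : pred Sym :=
  zspan (fun s => exists v : n.-tuple V, s = \prod_(i < n) sym_gen (tnth v i)).

HB.instance Definition _ (n : nat) :=
  GRing.isZmodClosed.Build Sym (sym_degree n) (zspan_zmod_closed _).
End SymmetricAlgebra.

Arguments sym_degree V n : clear implicits.

Section SymLift.
Context (V : zmodType) (A : comNzRingType) (f : {additive V -> A}).

Definition monom_eval (m : {cmonom V}) : A := \prod_(v <- finsupp m) f v ^+ m v.

Lemma monom_evalEw (d : {fset V}) (m : {cmonom V}) : (finsupp m `<=` d)%fset ->
  monom_eval m = \prod_(v <- d) f v ^+ m v.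
Proof.
move=> le; rewrite /monom_eval (big_fset_incl _ le) // => v _.
by rewrite -cmE_eq0 => /eqP->; rewrite expr0.
Qed.

Lemma monom_eval_mmorphism : mmorphism monom_eval.
Proof.
split=> [m n|]; last by rewrite /monom_eval mdom1 big_seq_fset0.
rewrite (monom_evalEw (fsubsetUl (finsupp m) (finsupp n))).
rewrite (monom_evalEw (fsubsetUr (finsupp m) (finsupp n))).
rewrite /monom_eval mdomD -big_split; apply: eq_bigr => v _.
by rewrite cmM exprD.
Qed.

HB.instance Definition _ :=
  isMultiplicative.Build {cmonom V} A monom_eval monom_eval_mmorphism.

Definition poly_eval : {malg int[{cmonom V}]} -> A := mmap intr monom_eval.
HB.instance Definition _ := GRing.RMorphism.on poly_eval.

Lemma poly_eval_indet v : poly_eval (indet v) = f v.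
Proof.
by rewrite indet.unlock /poly_eval mmapU mul1r /monom_eval mdomU big_seq_fset1 cmUU expr1.
Qed.

Lemma poly_eval_sym_relation x : sym_relation x -> poly_eval x = 0.
Proof.
have E (w : V) : (poly_eval : {rmorphism _ -> _}) (indet w) = f w.
  exact: poly_eval_indet.
case=> u [v ->]; rewrite rmorphB rmorphB !E.
by rewrite raddfD addrAC addrK subrr.
Qed.

Definition sym_lift (s : Sym V) : A := poly_eval (repr s).

Lemma sym_lift_pi p : sym_lift (\pi p) = poly_eval p.
Proof.
apply/eqP; rewrite -subr_eq0 -rmorphB; apply/eqP.
apply: (ideal_gen_ker poly_eval_sym_relation).
by rewrite (Quotient.idealrBE (@sym_ideal V : idealr _)) reprK.
Qed.

Lemma sym_lift_gen v : sym_lift (sym_gen v) = f v.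
Proof. by rewrite sym_lift_pi poly_eval_indet. Qed.

Lemma sym_lift_is_zmod_morphism : zmod_morphism sym_lift.
Proof.
by move=> s t; rewrite -[s]reprK -[t]reprK -rmorphB !sym_lift_pi rmorphB.
Qed.

Lemma sym_lift_is_monoid_morphism : monoid_morphism sym_lift.
Proof.
split=> [|s t]; first by rewrite -(rmorph1 \pi_(Sym V)) sym_lift_pi rmorph1.
by rewrite -[s]reprK -[t]reprK -rmorphM !sym_lift_pi rmorphM.
Qed.

HB.instance Definition _ :=
  GRing.isZmodMorphism.Build (Sym V) A sym_lift sym_lift_is_zmod_morphism.
HB.instance Definition _ :=
  GRing.isMonoidMorphism.Build (Sym V) A sym_lift sym_lift_is_monoid_morphism.
End SymLift.

Section Graphs.
Context (L : finType).

(* A directed multigraph on L, given by the multiplicity of each edge a -> b;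
   the product of {cmonom _} is the disjoint union of edge sets. *)
Definition digraph := {cmonom (L * L)%type}.
HB.instance Definition _ := ConomialDef.on digraph.

Definition edge (a b : L) : digraph := ucm (a, b).

Definition valence (G : digraph) (v : L) : nat :=
  (\sum_w (G (v, w) + G (w, v)))%N.

Definition regular_of (k : nat) (G : digraph) : bool :=
  [forall v, valence G v == k].

Definition regular (G : digraph) : bool := `[< exists k, regular_of k G >].

Lemma valence1 v : valence mone v = 0%N.
Proof. by rewrite /valence big1 // => w _; rewrite !cm1. Qed.

Lemma valenceM G H v : valence (mmul G H) v = (valence G v + valence H v)%N.
Proof.
by rewrite /valence -big_split; apply: eq_bigr => w _; rewrite !cmM addnACA.
Qed.

Lemma regular_of1 : regular_of 0 mone.
Proof. by apply/forallP => v; rewrite valence1. Qed.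

Lemma regular_ofM k l G H :
  regular_of k G -> regular_of l H -> regular_of (k + l) (mmul G H).
Proof.
move=> /forallP Gk /forallP Hl; apply/forallP => v.
by rewrite valenceM (eqP (Gk v)) (eqP (Hl v)).
Qed.

Definition regular_graph := {G : digraph | regular G}.
HB.instance Definition _ := SubChoice.on regular_graph.

Lemma regular1 : regular mone.
Proof. by apply/asboolP; exists 0%N; apply: regular_of1. Qed.

Lemma regularM (G H : regular_graph) : regular (mmul (val G) (val H)).
Proof.
have /asboolP[k Gk] := valP G; have /asboolP[l Hl] := valP H.
by apply/asboolP; exists (k + l)%N; apply: regular_ofM.
Qed.

Definition rg_one : regular_graph := exist _ mone regular1.
Definition rg_mul (G H : regular_graph) : regular_graph :=
  exist _ (mmul (val G) (val H)) (regularM G H).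

Lemma rg_mulA : associative rg_mul.
Proof. by move=> G H K; apply/val_inj/mulmA. Qed.
Lemma rg_mul1 : left_id rg_one rg_mul.
Proof. by move=> G; apply/val_inj/mul1m. Qed.
Lemma rg_mulr1 : right_id rg_one rg_mul.
Proof. by move=> G; apply/val_inj/mulm1. Qed.
Lemma rg_unit G H : rg_mul G H = rg_one -> G = rg_one /\ H = rg_one.
Proof. by move/(congr1 val)/unitm => [G1 H1]; split; apply/val_inj. Qed.
Lemma rg_mulC : commutative rg_mul.
Proof. by move=> G H; apply/val_inj/mulmC. Qed.

HB.instance Definition _ := Choice_isMonomialDef.Build regular_graph
  rg_mulA rg_mul1 rg_mulr1 rg_unit.
HB.instance Definition _ :=
  MonomialDef_isConomialDef.Build regular_graph rg_mulC.
End Graphs.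

HB.lock Definition graph_elt (L : finType) (G : regular_graph L) :
  {malg int[regular_graph L]} := << G >>.

Section InvariantRing.
Context (L : finType).

Local Notation graph_alg := {malg int[regular_graph L]}.
Implicit Types (G : regular_graph L) (H : digraph L) (x : graph_alg).

Definition loop_relation x : Prop :=
  exists a G, (0 < val G (a, a))%N /\ x = graph_elt G.

(* In the next two relations H is the set of edges left unchanged. *)
Definition sign_relation x : Prop :=
  exists a b H G G',
    [/\ val G = mmul (edge a b) H, val G' = mmul (edge b a) H
      & x = graph_elt G + graph_elt G'].

Definition plucker_relation x : Prop :=
  exists a b c d H G G' G'',
    [/\ val G = mmul (mmul (edge a b) (edge c d)) H,
        val G' = mmul (mmul (edge a d) (edge c b)) H,
        val G'' = mmul (mmul (edge a c) (edge b d)) H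
      & x = graph_elt G - (graph_elt G' + graph_elt G'')].

Definition graph_relation x : Prop :=
  [\/ loop_relation x, sign_relation x | plucker_relation x].

Definition graph_ideal : pred graph_alg := ideal_gen graph_relation.

Lemma edge_graph0 a b H G :
  val G = mmul (edge a b) H -> (graph_elt G)@_mone = 0.
Proof.
move=> GE; rewrite graph_elt.unlock mcoeffU; case: eqP => // G1.
move: GE; rewrite G1 => /esym/unitm[/eqP].
by rewrite /edge cm1_eq1.
Qed.

Lemma loop_edge a G :
  (0 < val G (a, a))%N -> exists H, val G = mmul (edge a a) H.
Proof.
move=> Ga; exists (divcm (val G) (ucm (a, a))); apply/eqP/cmP => p.
rewrite cmM divcmE /edge cmU; case: eqP => [<-|_]; first by rewrite subnKC.
by rewrite add0n subn0.
Qed.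

Lemma graph_relation0 x : graph_relation x -> x@_mone = 0.
Proof.
case=> [[a [G [/loop_edge[H GE] ->]]]|[a [b [H [G [G' [GE GE' ->]]]]]]|].
- exact: edge_graph0 GE.
- by rewrite mcoeffD (edge_graph0 GE) (edge_graph0 GE').
case=> a [b [c [d [H [G [G' [G'' [GE GE' GE'' ->]]]]]]]].
rewrite -mulmA in GE; rewrite -mulmA in GE'; rewrite -mulmA in GE''.
rewrite mcoeffB mcoeffD (edge_graph0 GE) (edge_graph0 GE') (edge_graph0 GE'').
by rewrite addr0.
Qed.

HB.instance Definition _ :=
  isIdealr.Build graph_alg graph_ideal (ideal_gen_malg graph_relation0).

Definition inv_ring := {ideal_quot (graph_ideal : idealr graph_alg)}.
HB.instance Definition _ := GRing.ComNzRing.on inv_ring.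

Definition XG (G : regular_graph L) : inv_ring := \pi_inv_ring (graph_elt G).

Lemma XGM G G' : XG (mmul G G') = XG G * XG G'.
Proof.
rewrite /XG -rmorphM graph_elt.unlock; congr (\pi _).
by rewrite malgM_def fgmulUU mulr1.
Qed.

Definition inv_degree (k : nat) : pred inv_ring :=
  zspan (fun y => exists G, regular_of k (val G) /\ y = XG G).

HB.instance Definition _ (k : nat) :=
  GRing.isZmodClosed.Build inv_ring (inv_degree k) (zspan_zmod_closed _).

(* The degree-one part V_L of the ring of invariants R_L. *)
Definition VL := {y : inv_ring | y \in inv_degree 1}.
HB.instance Definition _ := SubChoice.on VL.
HB.instance Definition _ := [SubChoice_isSubZmodule of VL by <:].

Definition sym_to_ring : Sym VL -> inv_ring := sym_lift (val : VL -> inv_ring).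
HB.instance Definition _ := GRing.RMorphism.on sym_to_ring.

Definition relation_ideal : pred (Sym VL) := fun s => sym_to_ring s == 0.

Definition quad_relation : pred (Sym VL) :=
  fun s => (s \in relation_ideal) && (s \in sym_degree VL 2).

Lemma quad_relation_zmod_closed : zmod_closed quad_relation.
Proof.
split=> [|s t /andP[s0 s2] /andP[t0 t2]]; apply/andP; split.
- by rewrite -topredE /relation_ideal /= rmorph0.
- exact: rpred0.
- by apply/eqP/(etrans (rmorphB _ s t)); rewrite /= (eqP s0) (eqP t0) subr0.
- exact: rpredB.
Qed.

HB.instance Definition _ :=
  GRing.isZmodClosed.Build (Sym VL) quad_relation quad_relation_zmod_closed.

(* I_L^(2) *)
Definition I2 := {s : Sym VL | s \in quad_relation}.
HB.instance Definition _ := SubChoice.on I2.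
HB.instance Definition _ := [SubChoice_isSubZmodule of I2 by <:].
End InvariantRing.

Arguments inv_degree L k : clear implicits.
Arguments quad_relation L : clear implicits.
Arguments sym_to_ring L : clear implicits.

Section Matchings.
Context (L : finType).

(* A graph with vertex set U is a graph on L in which the vertices outside U
   have valence 0; it is a matching on U if those in U have valence 1. *)
Definition is_matching (U : {set L}) (G : digraph L) : bool :=
  [forall v, valence G v == (v \in U)].

Definition matching (U : {set L}) := {G : digraph L | is_matching U G}.

Lemma glue_subproof (U : {set L}) (G : matching (~: U)) (D : matching U) :
  regular_of 1 (mmul (val G) (val D)).
Proof.
apply/forallP => v; rewrite valenceM (eqP (forallP (valP G) v)).
by rewrite (eqP (forallP (valP D) v)) inE; case: (v \in U).
Qed.

Lemma glue_regular (U : {set L}) (G : matching (~: U)) (D : matching U) :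
  regular (mmul (val G) (val D)).
Proof. by apply/asboolP; exists 1%N; apply: glue_subproof. Qed.

Definition glue (U : {set L}) (G : matching (~: U)) (D : matching U) :
  regular_graph L := exist _ (mmul (val G) (val D)) (glue_regular G D).

Lemma XG_glue_degree (U : {set L}) (G : matching (~: U)) (D : matching U) :
  XG (glue G D) \in inv_degree L 1.
Proof. by apply: zspan_gen; exists (glue G D); rewrite glue_subproof. Qed.

(* X_{GD}, as an element of V_L and as an element of Sym(V_L) *)
Definition XV (U : {set L}) (G : matching (~: U)) (D : matching U) : VL L :=
  exist _ (XG (glue G D)) (XG_glue_degree G D).
Definition XS (U : {set L}) (G : matching (~: U)) (D : matching U) : Sym (VL L) :=
  sym_gen (XV G D).

Definition simple_binomial (U : {set L}) (G G' : matching (~: U))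
    (D D' : matching U) : Sym (VL L) :=
  XS G D * XS G' D' - XS G D' * XS G' D.

Lemma simple_binomial_quad (U : {set L}) (G G' : matching (~: U))
    (D D' : matching U) :
  simple_binomial G G' D D' \in quad_relation L.
Proof.
have mon2 u v : sym_gen u * sym_gen v \in sym_degree (VL L) 2.
  apply: zspan_gen; exists [tuple u; v].
  by rewrite big_ord_recl big_ord1 !(tnth_nth u).
have ev u v : (sym_to_ring L : {rmorphism _ -> _}) (sym_gen u * sym_gen v)
    = val u * val v.
  by rewrite rmorphM /=; congr (_ * _); apply: (sym_lift_gen val).
apply/andP; split; last by apply: rpredB; apply: mon2.
apply/eqP; apply: (etrans (rmorphB _ _ _)); rewrite !ev /= -!XGM.
apply/eqP; rewrite subr_eq0; apply/eqP; congr XG; apply: val_inj => /=.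
by rewrite -!mulmA; congr mmul; rewrite mulmA mulmC (mulmC (val D)).
Qed.

Definition simple_relation (U : {set L}) (G G' : matching (~: U))
    (D D' : matching U) : I2 L :=
  exist _ (simple_binomial G G' D D') (simple_binomial_quad G G' D D').
End Matchings.

HB.lock Definition free_pair (M A : choiceType) (p : M * A) :
  {malg int[(M * A)%type]} := << p >>.

(* The tensor product over Z of an abelian group M and a ring A, as an
   A-module. *)
Section ExtensionOfScalars.
Context (M : zmodType) (A : nzRingType).

Local Notation free := {malg int[(M * A)%type]}.
Local Notation e m a := (free_pair (m, a)).

Definition bilinear_relation (x : free) : Prop :=
  (exists m m' a, x = e (m + m') a - e m a - e m' a) \/
  (exists m a a', x = e m (a + a') - e m a - e m a').

Definition tensor_kernel : pred free := zspan bilinear_relation.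
HB.instance Definition _ :=
  GRing.isZmodClosed.Build free tensor_kernel (zspan_zmod_closed _).

Definition tensor := Quotient.quot (GRing.ZmodClosed.clone free tensor_kernel _).
HB.instance Definition _ := GRing.Zmodule.on tensor.

Definition pure (m : M) (a : A) : tensor := \pi_tensor (e m a).

Lemma pure_rel x : bilinear_relation x -> \pi_tensor x = 0.
Proof.
move=> xrel; have : x \in tensor_kernel by apply: zspan_gen.
rewrite -[x]subr0 (Quotient.idealrBE (GRing.ZmodClosed.clone free tensor_kernel _)).
by rewrite subr0 => /eqP->; rewrite raddf0.
Qed.

Lemma pureDl m m' a : pure (m + m') a = pure m a + pure m' a.
Proof.
apply/eqP; rewrite -subr_eq0 opprD addrA /pure -!raddfB /=; apply/eqP.
by apply: pure_rel; left; exists m, m', a.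
Qed.

Lemma pureDr m a a' : pure m (a + a') = pure m a + pure m a'.
Proof.
apply/eqP; rewrite -subr_eq0 opprD addrA /pure -!raddfB /=; apply/eqP.
by apply: pure_rel; right; exists m, a, a'.
Qed.

Lemma tensor_ind (P : tensor -> Prop) :
    (forall m a, P (pure m a)) -> (forall s t, P s -> P t -> P (s + t)) ->
    (forall s, P s -> P (- s)) -> forall t, P t.
Proof.
move=> Pp PD PN t; have P0 : P 0.
  by rewrite -(subrr (pure 0 0)); apply: PD => //; apply: PN.
have PMn s (n : nat) : P s -> P (s *+ n).
  by move=> Ps; elim: n => [|n IH]; rewrite ?mulr0n // mulrS; apply: PD.
have PMz s (n : int) : P s -> P (s *~ n).
  by case: n => n Ps; rewrite ?NegzE ?mulrNz -pmulrn; do ?apply: PN; apply: PMn.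
rewrite -[t]reprK (monalgE (repr t)) raddf_sum.
elim/big_rec: _ => // -[m a] s _; apply: PD.
have -> : << (repr t)@_(m, a) *g (m, a) >> = e m a *~ (repr t)@_(m, a).
  apply/malgP => k; have ek : (e m a)@_k = ((m, a) == k)%:R.
    by rewrite free_pair.unlock mcoeffU.
  apply: etrans (esym (raddfMz (mcoeff k) _ _)).
  apply: etrans (esym (congr1 (fun z => z *~ _) ek)).
  by rewrite mcoeffU; case: eqP => _; rewrite ?mul0rz ?intz.
by apply: (eq_ind_r P (PMz _ _ (Pp m a)) (raddfMz \pi_tensor _ _)).
Qed.

Definition free_scale (r : A) (x : free) : tensor :=
  \sum_(k <- msupp x) pure k.1 (r * k.2) *~ x@_k.

Lemma free_scaleEw (d : {fset M * A}) r x : (msupp x `<=` d)%fset ->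
  free_scale r x = \sum_(k <- d) pure k.1 (r * k.2) *~ x@_k.
Proof.
move=> le; rewrite /free_scale (big_fset_incl _ le) // => k _ /mcoeff_outdom ->.
by rewrite mulr0z.
Qed.

Lemma free_scale_is_zmod_morphism r : zmod_morphism (free_scale r).
Proof.
move=> x y; rewrite (free_scaleEw _ (msuppB_le x y)).
rewrite (free_scaleEw _ (fsubsetUl (msupp x) (msupp y))).
rewrite (free_scaleEw _ (fsubsetUr (msupp x) (msupp y))).
by rewrite -sumrB; apply: eq_bigr => k _; rewrite mcoeffB mulrzBr.
Qed.

HB.instance Definition _ r :=
  GRing.isZmodMorphism.Build free tensor (free_scale r)
    (free_scale_is_zmod_morphism r).

Lemma free_scaleE r m a : free_scale r (e m a) = pure m (r * a).
Proof.
have le : (msupp (e m a) `<=` [fset (m, a)])%fset.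
  by rewrite free_pair.unlock; apply: msuppU_le.
by rewrite (free_scaleEw _ le) big_seq_fset1 free_pair.unlock mcoeffUU.
Qed.

Lemma free_scale_rel r x : bilinear_relation x -> free_scale r x = 0.
Proof.
have E m a : (free_scale r : {additive _ -> _}) (e m a) = pure m (r * a).
  exact: free_scaleE.
case=> [[m [m' [a ->]]]|[m [a [a' ->]]]]; rewrite raddfB raddfB !E.
  by rewrite pureDl addrAC addrK subrr.
by rewrite mulrDr pureDr addrAC addrK subrr.
Qed.

Definition tensor_scale (r : A) (t : tensor) : tensor := free_scale r (repr t).

Lemma tensor_scale_pi r x : tensor_scale r (\pi x) = free_scale r x.
Proof.
apply/eqP; rewrite -subr_eq0 -raddfB; apply/eqP.
apply: (zspan_ker (@free_scale_rel r)).
by rewrite (Quotient.idealrBE (GRing.ZmodClosed.clone free tensor_kernel _)) reprK.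
Qed.

Lemma tensor_scaleE r m a : tensor_scale r (pure m a) = pure m (r * a).
Proof. by rewrite tensor_scale_pi free_scaleE. Qed.

Lemma tensor_scaleDr r : {morph tensor_scale r : s t / s + t}.
Proof.
by move=> s t; rewrite -[s]reprK -[t]reprK -raddfD !tensor_scale_pi raddfD.
Qed.

Lemma tensor_scaleN r : {morph tensor_scale r : s / - s}.
Proof. by move=> s; rewrite -[s]reprK -raddfN !tensor_scale_pi raddfN. Qed.

Lemma tensor_scaleA r r' t :
  tensor_scale r (tensor_scale r' t) = tensor_scale (r * r') t.
Proof.
elim/tensor_ind: t => [m a|s t Es Et|s Es].
- by rewrite !tensor_scaleE mulrA.
- by rewrite !tensor_scaleDr Es Et.
- by rewrite !tensor_scaleN Es.
Qed.

Lemma tensor_scale1 : left_id 1 tensor_scale.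
Proof.
move=> t; elim/tensor_ind: t => [m a|s t Es Et|s Es].
- by rewrite tensor_scaleE mul1r.
- by rewrite tensor_scaleDr Es Et.
- by rewrite tensor_scaleN Es.
Qed.

Lemma tensor_scaleDl t : {morph tensor_scale^~ t : r r' / r + r'}.
Proof.
move=> r r'; elim/tensor_ind: t => [m a|s t Es Et|s Es].
- by rewrite !tensor_scaleE mulrDl pureDr.
- by rewrite !tensor_scaleDr Es Et addrACA.
- by rewrite !tensor_scaleN Es opprD.
Qed.

HB.instance Definition _ := GRing.Zmodule_isLmodule.Build A tensor
  tensor_scaleA tensor_scale1 tensor_scaleDr tensor_scaleDl.
End ExtensionOfScalars.

(* The subring Z[1/N] of the rationals. *)
Section IntegersInverting.
Context (N : nat).

Definition is_Zinv : pred rat :=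
  fun x => `[< exists p : {poly int}, x = (map_poly intr p).[N%:R^-1] >].

Lemma is_Zinv_subring_closed : subring_closed is_Zinv.
Proof.
split=> [|x y /asboolP[p ->] /asboolP[q ->]|x y /asboolP[p ->] /asboolP[q ->]].
- by apply/asboolP; exists 1; rewrite rmorph1 hornerC.
- by apply/asboolP; exists (p - q); rewrite rmorphB hornerD hornerN.
- by apply/asboolP; exists (p * q); rewrite rmorphM hornerM.
Qed.

HB.instance Definition _ :=
  GRing.isSubringClosed.Build rat is_Zinv is_Zinv_subring_closed.

Definition Zinv := {x : rat | x \in is_Zinv}.
HB.instance Definition _ := SubChoice.on Zinv.
HB.instance Definition _ := [SubChoice_isSubComNzRing of Zinv by <:].
End IntegersInverting.

(* Main.v *)
Require Import Defs.
From HB Require Import structures.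
From mathcomp Require Import all_boot all_order all_algebra.
From mathcomp Require Import finmap boolp monalg zify.

Set Implicit Arguments.
Unset Strict Implicit.
Unset Printing Implicit Defensive.

Import GRing.Theory.
Local Open Scope ring_scope.
Local Open Scope quotient_scope.

(** Why the theorem holds.  A cyclic word [w = w1 w2 .. wn] that runs once through
    [L] determines the element [T w] of Sym^2(V_L), the product of the matching
    [w1w2, w3w4, ..] and the matching [w2w3, .., wnw1].  By the Plucker relation,
    exchanging two neighbours [a], [b] of [w] changes the sign of [T w], up to a
    term in which [a] and [b] are joined by an edge of both matchings.  This is the
    Clifford relation [ab + ba = <a,b>], so [T w] behaves as the trace of a product
    of Clifford generators ([word_trace_clifford]).  Such generators live in a
    quadratic space of dimension 4, because V_L (x) V_L consists of invariants of
    SL_2 x SL_2, whereas R_L^(2) consists of invariants of SL_2, that is of SO_3;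
    there the generators are traceless 2 x 2 matrices.  The passage from rank 4 to
    rank 3 is made by the simple binomial relations: by Plucker, each of them
    equals an alternating sum over four adjacent letters ([word_trace_alt]), the
    analogue of a 4 x 4 Gram determinant.

    Let [W] be the quotient of Sym(V_L) by those elements that have a multiple by
    a power of 2 in the span of the simple binomial relations.  For a word [u] let
    [u'] be its reversal, with the sign (-1)^|u|.  For traceless 2 x 2 matrices
    [u + u'] is the scalar [tr u].  Accordingly [u + u'] can be moved past every
    letter inside [T] with values in [W] ([clifford_central]).  Hence there are
    well defined products of traces tr(w1) .. tr(wk), and since
    [tr u tr v = tr (uv) + tr (uv')], they satisfy the Plucker relation.  Reading a
    graph of valence two as its set of cycles, one obtains a value in [W] for every
    graph; the cycles of a graph are determined by its edges up to rotation and
    reversal ([cycles_value_unique]), and the values satisfy the loop, sign and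
    Plucker relations ([graph_value_plucker]).

    So there is an additive map from R_L to [W].  On the graph [Gamma Gamma'] of
    two matchings, joining cycles by Plucker relations until one remains shows
    that its value is [2 X_Gamma X_Gamma'] ([graph_value_matchings]).  A quadratic
    relation maps to 0 in R_L, so its double is 0 in [W], and it has a multiple by
    a power of 2 in the span of the simple binomial relations.  Finally 2 is
    invertible in Z[1/12!]. *)

(** * Traces on words *)

Section Signs.
Context {W : zmodType}.
Implicit Types (b c : bool) (x y : W).

Definition sg b x : W := if b then - x else x.

Lemma sgD b x y : sg b (x + y) = sg b x + sg b y.
Proof. by case: b; rewrite //= opprD. Qed.

Lemma sgN b x : sg b (- x) = - sg b x.
Proof. by case: b. Qed.

Lemma sg_sg b c x : sg b (sg c x) = sg (b (+) c) x.
Proof. by case: b; case: c; rewrite //= opprK. Qed.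

Lemma sgK b : involutive (sg b).
Proof. by move=> x; rewrite sg_sg addbb. Qed.

Lemma sgC b c x : sg b (sg c x) = sg c (sg b x).
Proof. by rewrite !sg_sg addbC. Qed.

Lemma sg_negb b x : sg (~~ b) x = - sg b x.
Proof. by case: b; rewrite /= ?opprK. Qed.

Lemma sg0 b : sg b 0 = 0 :> W.
Proof. by case: b; rewrite /= ?oppr0. Qed.
End Signs.

Section Traces.
Context {L : Type} {W : zmodType}.
Implicit Types (f : seq L -> W) (u v w X Y Z : seq L).

(** The value of [f] at [(u + u') Z], where [u'] is the reversal of [u] with the
    sign (-1)^|u|.  If [f] is the trace and the letters are traceless 2 x 2
    matrices, it is [tr u * tr Z]. *)
Definition symm f u Z : W := f (u ++ Z) + sg (odd (size u)) (f (rev u ++ Z)).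

(** The properties of the trace of a product of traceless 2 x 2 matrices on which
    everything rests: reversal is the adjugate up to sign, and [u + u'] is scalar. *)
Record trace_like f : Prop := TraceLike {
  trace_cyc : forall X Y, f (X ++ Y) = f (Y ++ X);
  trace_rev : forall X, f (rev X) = sg (odd (size X)) (f X);
  trace_central : forall u X Y, symm f u (X ++ Y) = symm f u (Y ++ X) }.

Section Theory.
Context (f : seq L -> W) (fT : trace_like f).

Lemma symm_rev u Z : symm f (rev u) Z = sg (odd (size u)) (symm f u Z).
Proof. by rewrite /symm size_rev revK sgD sgK addrC. Qed.

Lemma symm_seq1 (a : L) Z : symm f [:: a] Z = 0.
Proof. by rewrite /symm /= subrr. Qed.

Lemma symm_swap u Z : symm f u Z = symm f Z u.
Proof.
rewrite /symm (trace_cyc fT u Z) -{2}(revK Z) -rev_cat (trace_rev fT) sg_sg.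
by rewrite size_cat size_rev oddD addbC -addbA addbb addbF.
Qed.

Lemma symm_rot u v Z : symm f (u ++ v) Z = symm f (v ++ u) Z.
Proof. by rewrite !(symm_swap _ Z) (trace_central fT). Qed.

(** Because [u + u'] is central, it can be inserted at any place of a word. *)
Lemma symm_front u w Z :
  symm f u (w ++ Z) = f (w ++ u ++ Z) + sg (odd (size u)) (f (w ++ rev u ++ Z)).
Proof.
rewrite (trace_central fT) /symm !catA.
by rewrite (trace_cyc fT (u ++ Z)) (trace_cyc fT (rev u ++ Z)) !catA.
Qed.

Lemma symmC u w Z : symm (symm f u) w Z = symm (symm f w) u Z.
Proof.
rewrite {1}/symm !symm_front [RHS]/symm /symm !sgD addrACA.
by congr (_ + _ + (_ + _)); rewrite sgC.
Qed.

(** The identity [tr (uv) + tr (uv') = tr u * tr v] of 2 x 2 matrices. *)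
Lemma symm_merge u v Z :
  symm f (u ++ v) Z + sg (odd (size v)) (symm f (u ++ rev v) Z) =
  symm (symm f u) v Z.
Proof.
rewrite symmC [RHS]/symm (symm_front v u Z) /symm.
rewrite !rev_cat revK !size_cat size_rev !oddD -!catA !sgD !sg_sg addrACA.
congr (_ + _); rewrite addrC; congr (sg _ _ + sg _ _).
by rewrite addbC -addbA addbb addbF.
Qed.

Lemma symm_mid u w X Y :
  symm (symm f u) w (X ++ Y) =
  symm f w (X ++ u ++ Y) + sg (odd (size u)) (symm f w (X ++ rev u ++ Y)).
Proof.
have cyc w' : symm f u (w' ++ X ++ Y) =
    f (w' ++ X ++ u ++ Y) + sg (odd (size u)) (f (w' ++ X ++ rev u ++ Y)).
  rewrite catA (trace_central fT) /symm.
  by rewrite !(catA _ Y) trace_cyc // (trace_cyc fT (rev u ++ Y)) -!catA.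
rewrite {1}/symm !cyc /symm !sgD addrACA.
by congr (_ + _ + (_ + _)); rewrite sgC.
Qed.

(** [symm f u] is again like a trace, namely like [tr u * tr].  This allows a
    product of any number of traces to be formed by iteration. *)
Lemma symm_trace u : trace_like (symm f u).
Proof.
have cyc := trace_central fT u; split=> // [Z|w X Y].
  rewrite /symm sgD sg_sg addrC.
  rewrite -[u in X in _ + X]revK -!rev_cat !(trace_rev fT) !sg_sg.
  rewrite !size_cat size_rev oddD.
  rewrite (trace_cyc fT Z u) (trace_cyc fT Z (rev u)).
  by case: (odd (size u)); case: (odd (size Z)).
rewrite symm_mid (trace_central fT w X (u ++ Y)).
rewrite (trace_central fT w X (rev u ++ Y)) -!catA.
exact: symmC.
Qed.
End Theory.

(** The product of the traces of the words in [ws], times 2: the empty word at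
    which the iteration ends is the identity matrix, of trace 2. *)
Definition multi_trace f (ws : seq (seq L)) : W := foldl symm f ws [::].

Lemma multi_trace_front f (s1 s2 : seq (seq L)) w : trace_like f ->
  multi_trace f (s1 ++ w :: s2) = multi_trace f (w :: s1 ++ s2).
Proof.
elim: s1 f => //= u s1 IH f fT.
rewrite /multi_trace /= -/(multi_trace _ _) IH; last exact: symm_trace.
rewrite /multi_trace /=.
by have -> : symm (symm f u) w = symm (symm f w) u by apply/funext/symmC.
Qed.

Lemma multi_traceD f g h (c : bool) (ws : seq (seq L)) :
  (forall Z, f Z = g Z + sg c (h Z)) ->
  multi_trace f ws = multi_trace g ws + sg c (multi_trace h ws).
Proof.
elim: ws f g h => [|w ws IH] f g h E; first exact: E.
apply: IH => Z; rewrite /symm !E !sgD addrACA.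
by congr (_ + _ + (_ + _)); rewrite sgC.
Qed.

Lemma multi_trace_rot f u v ws : trace_like f ->
  multi_trace f ((u ++ v) :: ws) = multi_trace f ((v ++ u) :: ws).
Proof.
move=> fT; rewrite /multi_trace /=.
by have -> : symm f (u ++ v) = symm f (v ++ u) by apply/funext/symm_rot.
Qed.

Lemma multi_trace0 ws : multi_trace (fun=> 0 : W) ws = 0.
Proof.
rewrite /multi_trace; elim: ws => //= w ws IH.
have -> // : symm (fun=> 0) w = (fun=> 0) :> (seq L -> W).
by apply/funext=> Z; rewrite /symm sg0 addr0.
Qed.

Lemma multi_trace_rev f w ws :
  multi_trace f (rev w :: ws) = sg (odd (size w)) (multi_trace f (w :: ws)).
Proof.
rewrite -[RHS]add0r -[X in _ = X + _](multi_trace0 ws).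
by apply: (@multi_traceD (symm f (rev w)) _ (symm f w)) => Z; rewrite add0r symm_rev.
Qed.

(** A single letter is traceless; for graphs this becomes the loop relation. *)
Lemma multi_trace_loop f (a : L) (s1 s2 : seq (seq L)) : trace_like f ->
  multi_trace f (s1 ++ [:: a] :: s2) = 0.
Proof.
move=> fT; rewrite multi_trace_front // -[RHS](multi_trace0 (s1 ++ s2)).
rewrite {1}/multi_trace /=.
by have -> : symm f [:: a] = (fun=> 0) by apply/funext/symm_seq1.
Qed.

(** Seen on graphs, with the words as cycles, this is the Plucker relation: it
    joins two cycles in the two possible ways. *)
Lemma multi_trace_merge f u v ws : trace_like f ->
  multi_trace f ((u ++ v) :: ws) =
  multi_trace f [:: u, v & ws] -
  sg (odd (size v)) (multi_trace f ((u ++ rev v) :: ws)).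
Proof.
move=> fT; apply/eqP; rewrite -subr_eq opprK eq_sym; apply/eqP.
apply: (@multi_traceD (symm (symm f u) v) (symm f (u ++ v)) (symm f (u ++ rev v))).
by move=> Z; rewrite symm_merge.
Qed.

Lemma multi_trace1 f w : trace_like f -> multi_trace f [:: w] = f w *+ 2.
Proof.
move=> fT; rewrite /multi_trace /= /symm !cats0 (trace_rev fT) sgK.
by rewrite mulr2n.
Qed.
End Traces.

(** * A centrality criterion from Clifford relations *)

(** A family of functions of words that satisfies Clifford relations is like a
    trace as soon as one alternating expression in four letters vanishes.  The
    index [ext a b i] stands for the context [i] multiplied by the scalar [<a,b>],
    so that [f_clifford] reads [ab + ba = <a,b>]; the expression in [f_alt] is the
    commutator of [abc - cba] with [d]. *)
Section Clifford.
Context {L I : Type} {W : zmodType} (f : I -> seq L -> W) (ext : L -> L -> I -> I).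
Context (two_regular : forall x : W, x *+ 2 = 0 -> x = 0).
Context (f_cyc : forall i X Y, f i (X ++ Y) = f i (Y ++ X)).
Context (f_rev : forall i X, f i (rev X) = sg (odd (size X)) (f i X)).
Context (f_clifford : forall i a b Z,
  f i [:: a, b & Z] + f i [:: b, a & Z] = f (ext a b i) Z).
Context (f_alt : forall i a b c d Z,
  f i [:: a, b, c, d & Z] - f i [:: c, b, a, d & Z]
  - f i [:: d, a, b, c & Z] + f i [:: d, c, b, a & Z] = 0).
Implicit Types (u v w X Y Z : seq L).

Lemma clifford_mid i a b X Y :
  f i (X ++ [:: a, b & Y]) + f i (X ++ [:: b, a & Y]) = f (ext a b i) (X ++ Y).
Proof. by rewrite !(f_cyc _ X) /= f_clifford. Qed.

Lemma alt_mid i a b c d X Y :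
  f i (X ++ [:: a, b, c, d & Y]) - f i (X ++ [:: c, b, a, d & Y])
  - f i (X ++ [:: d, a, b, c & Y]) + f i (X ++ [:: d, c, b, a & Y]) = 0.
Proof. by rewrite !(f_cyc _ X) /= f_alt. Qed.

Lemma symm_clifford i a b X Y Z :
  symm (f i) (X ++ [:: a, b & Y]) Z + symm (f i) (X ++ [:: b, a & Y]) Z =
  symm (f (ext a b i)) (X ++ Y) Z.
Proof.
rewrite /symm !rev_cat !rev_cons -!cats1 -!catA !size_cat /=.
rewrite !addnS /= negbK addrACA -sgD; congr (_ + sg _ _).
  by rewrite clifford_mid.
by rewrite addrC clifford_mid.
Qed.

(** The alternating expression in [a, b, c, d] is invariant under reversal, and it
    vanishes with any letters next to it; so it also vanishes after [Y] is put on
    the right of it and the sum with the signed reversal is taken. *)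
Lemma symm_alt i a b c d Y Z :
  symm (f i) [:: a, b, c, d & Y] Z - symm (f i) [:: c, b, a, d & Y] Z
  - symm (f i) [:: d, a, b, c & Y] Z + symm (f i) [:: d, c, b, a & Y] Z = 0.
Proof.
rewrite /symm !rev_cons -!cats1 -!catA /= !opprD.
rewrite [LHS](AC (((2*2)*2)*2) ((1*3*5*7)*(2*4*6*8)))/=.
rewrite f_alt add0r -!sgN -!sgD -[RHS](sg0 (odd (size Y))) !negbK.
by congr (sg _ _); rewrite -[RHS](alt_mid i a b c d (rev Y) Z) (ACl (4*3*2*1)).
Qed.

(** By induction on the length of [u].  By the Clifford relation, exchanging two
    neighbours in [u] changes the sign of the defect [D u] of centrality, because
    the remaining term has a shorter word.  For at least four letters, the
    four terms of [symm_alt] are then all equal to [D u], so [4 D u = 0]; for three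
    letters the claim is the vanishing of the alternating expression itself. *)
Lemma clifford_central i u X Y : symm (f i) u (X ++ Y) = symm (f i) u (Y ++ X).
Proof.
suff move1 (v : L) Z : symm (f i) u (v :: Z) = symm (f i) u (Z ++ [:: v]).
  by elim: X Y => [|v X IH] Y; rewrite ?cats0 //= move1 -catA IH -catA.
move: {2}(size u) (leqnn (size u)) => n.
elim/ltn_ind: n => n IH in i u *; case: u => [|a u] le_n.
  by rewrite /symm /= -cat1s f_cyc.
case: u => [|b u] in le_n *; first by rewrite !symm_seq1.
case: u => [|c u] in le_n *.
  by rewrite /symm /= !f_clifford -cat1s f_cyc.
pose D w : W := symm (f i) w (v :: Z) - symm (f i) w (Z ++ [:: v]).
have swap P Q x y : (size (P ++ Q) < n)%N ->
    D (P ++ [:: x, y & Q]) = - D (P ++ [:: y, x & Q]).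
  move=> lt_n; apply/eqP; rewrite -addr_eq0 /D addrACA -opprD !symm_clifford.
  by rewrite (IH _ lt_n) ?subrr.
suff : D [:: a, b, c & u] = 0 by move/eqP; rewrite subr_eq0 => /eqP.
case: u => [|d u] in le_n swap *.
  have rotv x y z : f i [:: x, y, z & Z ++ [:: v]] = f i [:: v, x, y, z & Z].
    exact: (f_cyc i [:: x, y, z & Z] [:: v]).
  by rewrite /D /symm /= !rotv opprB addrA addrAC f_alt.
have lt2 P Q x y : (size P + size Q).+2 = (size u).+4 ->
    D (P ++ [:: x, y & Q]) = - D (P ++ [:: y, x & Q]).
  by move=> sz; apply: swap; rewrite size_cat; apply: leq_trans le_n; rewrite /= -sz ltnS leqnSn.
have swap0 x y z t : D [:: x, y, z, t & u] = - D [:: y, x, z, t & u].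
  exact: (lt2 [::]).
have swap1 x y z t : D [:: x, y, z, t & u] = - D [:: x, z, y, t & u].
  exact: (lt2 [:: x]).
have swap2 x y z t : D [:: x, y, z, t & u] = - D [:: x, y, t, z & u].
  exact: (lt2 [:: x; y]).
(* The permutations cbad, dabc and dcba of abcd have signs -1, -1 and +1. *)
have E2 : D [:: c, b, a, d & u] = - D [:: a, b, c, d & u].
  by rewrite swap0 swap1 swap0 opprK.
have E3 : D [:: d, a, b, c & u] = - D [:: a, b, c, d & u].
  by rewrite swap0 swap1 swap2 opprK.
have E4 : D [:: d, c, b, a & u] = D [:: a, b, c, d & u].
  by rewrite swap0 swap1 swap2 E2 !opprK.
have : D [:: a, b, c, d & u] - D [:: c, b, a, d & u]
       - D [:: d, a, b, c & u] + D [:: d, c, b, a & u] = 0.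
  rewrite /D !opprB [LHS](AC (((2*2)*2)*2) ((1*4*6*7)*(2*3*5*8)))/=.
  rewrite symm_alt add0r -oppr0 -(symm_alt i a b c d u (Z ++ [:: v])).
  by rewrite !opprD !opprK.
rewrite E2 E3 E4 !opprK -mulr2n -mulrSr -mulrSr => D0.
by apply/two_regular/two_regular; rewrite -mulrnA.
Qed.

Lemma clifford_trace i : trace_like (f i).
Proof. by split=> // u X Y; apply: clifford_central. Qed.
End Clifford.

(** * Hamiltonian words and pairs of matchings *)

Definition flip {T : Type} (p : T * T) : T * T := (p.2, p.1).

Ltac perm_by_count :=
  apply/permP => ?; rewrite ?(count_cat, count_rev, =^~ cats1) /flip /=;
  rewrite ?count_cat /= ?count_cat /=; clear; lia.

Lemma seq2_ind (T : Type) (P : seq T -> Prop) :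
  P [::] -> (forall a, P [:: a]) -> (forall a b s, P s -> P [:: a, b & s]) ->
  forall s, P s.
Proof.
move=> P0 P1 P2; fix IH 1; case=> [|a [|b s]]; first exact: P0.
  exact: P1.
exact/P2/IH.
Qed.

Section Words.
Context {L : eqType}.
Implicit Types (s w X Y Z : seq L) (e g : seq (L * L)).

(** The first, third, .. edges of the path [w].  A last letter left alone gives a
    loop, so that words of odd length have value 0 in what follows. *)
Fixpoint alternate w : seq (L * L) :=
  match w with
  | [:: a, b & w'] => (a, b) :: alternate w'
  | [:: a] => [:: (a, a)]
  | [::] => [::]
  end.

Lemma alternate_cat X Y :
  ~~ odd (size X) -> alternate (X ++ Y) = alternate X ++ alternate Y.
Proof.
elim/seq2_ind: X => //= a b X IH; rewrite negbK => ev.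
by rewrite IH.
Qed.

Lemma alternate_cons2 a b X : alternate [:: a, b & X] = (a, b) :: alternate X.
Proof. by []. Qed.

Lemma alternate_rcons2 X a b : ~~ odd (size X) ->
  alternate (rcons (rcons X a) b) = alternate X ++ [:: (a, b)].
Proof. by move=> evenX; rewrite -!cats1 -catA alternate_cat. Qed.

Lemma alternate_odd w : odd (size w) ->
  exists a e, perm_eq (alternate w) ((a, a) :: e).
Proof.
elim/seq2_ind: w => [//|a _|a b s IH /=]; first by exists a, [::].
rewrite negbK => /IH[c [e pe]]; exists c, ((a, b) :: e).
apply: (@perm_trans _ ((a, b) :: (c, c) :: e)); first by rewrite perm_cons.
perm_by_count.
Qed.

Lemma alternate_rev w :
  ~~ odd (size w) -> perm_eq (alternate (rev w)) (map flip (alternate w)).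
Proof.
elim/seq2_ind: w => //= a b s IH; rewrite negbK => ev.
rewrite !rev_cons -!cats1 -catA alternate_cat ?size_rev //=.
by rewrite perm_catC /= perm_cons IH.
Qed.

Lemma alternate_rot2 w :
  ~~ odd (size w) -> perm_eq (alternate (rot 2 w)) (alternate w).
Proof.
case: w => [|a [|b s]] //=; rewrite negbK => ev.
by rewrite /rot /= drop0 take0 alternate_cat //= perm_catC.
Qed.

Lemma size_alternate_rot w : size (alternate (rot 1 w)) = size (alternate w).
Proof.
have sz X : size (alternate X) = uphalf (size X).
  by elim/seq2_ind: X => //= a b s ->.
by rewrite !sz size_rot.
Qed.
End Words.

Arguments alternate : simpl never.

(** What is needed of the product of two matchings, given by lists of edges, in
    Sym^2(V_L) modulo simple binomial relations; lists of edges that are not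
    matchings have product 0, which makes all the relations unconditional. *)
Record matching_form (L : eqType) (W : zmodType)
    (d : seq (L * L) -> seq (L * L) -> W) : Prop := MatchingForm {
  mf_sym : forall e g, d e g = d g e;
  mf_perm : forall e e' g, perm_eq e e' -> d e g = d e' g;
  mf_flip : forall a b e g, d ((a, b) :: e) g = - d ((b, a) :: e) g;
  mf_loop : forall a e g, d ((a, a) :: e) g = 0;
  mf_plucker : forall a b c c' e g,
    d [:: (a, b), (c, c') & e] g =
    d [:: (a, c'), (c, b) & e] g + d [:: (a, c), (b, c') & e] g;
  mf_binomial : forall a b c c' e g,
    d [:: (a, b), (c, c') & e] [:: (b, c), (a, c') & g] =
    d [:: (b, c), (a, c') & e] [:: (a, b), (c, c') & g] }.

Section WordTrace.
Context {L : eqType} {W : zmodType} (d : seq (L * L) -> seq (L * L) -> W).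
Context (dF : matching_form d).
Implicit Types (s w X Y Z : seq L) (e g E : seq (L * L)).

Lemma mf_perm2 e e' g g' : perm_eq e e' -> perm_eq g g' -> d e g = d e' g'.
Proof.
by move=> pe pg; rewrite (mf_perm dF _ pe) !(mf_sym dF e') (mf_perm dF _ pg).
Qed.

Lemma mf_flips (s e : seq (L * L)) g : d (map flip s ++ e) g = sg (odd (size s)) (d (s ++ e) g).
Proof.
elim: s e => //= -[a b] s IH e; rewrite (mf_flip dF b a) sg_negb; congr (- _).
have -> : d ((a, b) :: map flip s ++ e) g = d (map flip s ++ (a, b) :: e) g.
  apply: mf_perm2 => //; perm_by_count.
rewrite IH; congr (sg _ _); apply: mf_perm2 => //; perm_by_count.
Qed.

Lemma mf_flip_r a b e g : d e ((a, b) :: g) = - d e ((b, a) :: g).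
Proof. by rewrite !(mf_sym dF e) (mf_flip dF). Qed.

(** The product of the two matchings of the cycle [w], each enlarged by the edges
    [E].  The second copy of [E] is reversed in order to have sign +1 in
    [word_trace_clifford].  The empty word counts twice, like the trace of the
    identity matrix: the Clifford relation holds for words of two letters only
    with this value. *)
Definition word_trace E w : W :=
  if w is [::] then d E (map flip E) *+ 2
  else d (E ++ alternate w) (map flip E ++ alternate (rot 1 w)).
Arguments word_trace : simpl never.

Lemma mf_flips2 E e g :
  d (map flip E ++ e) (E ++ g) = d (E ++ e) (map flip E ++ g).
Proof.
by rewrite mf_flips (mf_sym dF _ (E ++ g)) -mf_flips (mf_sym dF).
Qed.

Lemma word_trace_odd E w : odd (size w) -> word_trace E w = 0.
Proof.
case: w => // a w oddw; have [b [e pe]] := alternate_odd oddw.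
rewrite /word_trace -[RHS](mf_loop dF b (E ++ e) (map flip E ++ alternate (rot 1 (a :: w)))).
apply: mf_perm2 => //; apply: (@perm_trans _ (E ++ (b, b) :: e)).
  by rewrite perm_cat2l.
perm_by_count.
Qed.

(** A rotation by one letter exchanges the two matchings, whose product is
    symmetric. *)
Lemma word_trace_rot1 E a X : word_trace E (a :: X) = word_trace E (rcons X a).
Proof.
have [odd_w|even_w] := boolP (odd (size (a :: X))).
  by rewrite !word_trace_odd // size_rcons.
case: X even_w => [|b X] // even_w.
rewrite /word_trace rcons_cons !rot1_cons (mf_sym dF) mf_flips2.
apply: mf_perm2 => //; rewrite perm_cat2l -!cats1 -catA.
move: even_w; rewrite /= negbK => even_X.
by rewrite alternate_cat //= perm_sym perm_catC.
Qed.

Lemma word_trace_cyc E X Y : word_trace E (X ++ Y) = word_trace E (Y ++ X).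
Proof.
elim: X Y => [|a X IH] Y; rewrite ?cats0 //= word_trace_rot1.
by rewrite -cats1 -catA IH -catA.
Qed.

Lemma word_trace_rev E X : word_trace E (rev X) = sg (odd (size X)) (word_trace E X).
Proof.
have [odd_w|even_w] := boolP (odd (size X)).
  by rewrite !word_trace_odd ?size_rev // sg0.
case: X even_w => [|a X] // even_w.
have even_w1 : ~~ odd (size (rot 1 (a :: X))) by rewrite size_rot.
have -> : word_trace E (rev (a :: X)) =
    d (E ++ map flip (alternate (a :: X))) (map flip E ++ map flip (alternate (rot 1 (a :: X)))).
  rewrite /word_trace; case Er : (rev (a :: X)) => [|b Y].
    by move/(congr1 size): Er; rewrite size_rev.
  rewrite -Er; apply: mf_perm2; rewrite perm_cat2l; first exact: alternate_rev.
  rewrite -rev_rotr; apply: perm_trans (alternate_rev _) _.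
    by rewrite size_rotr.
  apply: perm_map; rewrite perm_sym -{1}[a :: X](rotrK 1) -rotS ?size_rotr //.
    by apply: alternate_rot2; rewrite size_rotr.
  by case: (X) even_w.
rewrite /sg /word_trace.
set p := alternate _; set q := alternate _.
have sz : size q = size p by apply: size_alternate_rot.
have -> : d (E ++ map flip p) (map flip E ++ map flip q) =
    d (map flip p ++ E) (map flip q ++ map flip E).
  by apply: mf_perm2; rewrite perm_catC.
rewrite mf_flips (mf_sym dF) mf_flips sz sgK (mf_sym dF).
by apply: mf_perm2; rewrite perm_catC.
Qed.

(** Let [y] and [x] be the letters after and before the two exchanged letters in
    the cyclic word.  One of the matchings of both words contains the edge [ab], and
    the other ones differ by a Plucker relation between the edges [by, xa]. *)
Lemma word_trace_clifford E a b Z :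
  word_trace E [:: a, b & Z] + word_trace E [:: b, a & Z] =
  word_trace ((a, b) :: E) Z.
Proof.
have [odd_w|] := boolP (odd (size Z)).
  by rewrite !word_trace_odd ?addr0 //= negbK.
case/lastP: Z => [_|[|y Z] x] //=.
  rewrite /word_trace mulr2n !rot1_cons /=; congr (_ + _); first by apply: mf_perm2; perm_by_count.
  have -> : d (E ++ [:: (b, a)]) (map flip E ++ [:: (a, b)]) =
     d ((b, a) :: E) ((a, b) :: map flip E) by apply: mf_perm2; perm_by_count.
  by rewrite (mf_flip dF) (mf_sym dF) (mf_flip dF) opprK (mf_sym dF).
rewrite size_rcons /= negbK => even_Z.
set Z' := y :: rcons Z x.
have -> : word_trace ((a, b) :: E) Z' =
    d ((a, b) :: E ++ alternate Z')
      ((b, a) :: map flip E ++ alternate Z ++ [:: (x, y)]).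
  by rewrite /word_trace /Z' rot1_cons alternate_rcons2.
rewrite /word_trace /Z' !rot1_cons !rcons_cons !alternate_cons2 -/Z'.
rewrite !alternate_rcons2 //.
set o := alternate Z'; set o' := alternate Z; set E' := map flip E.
rewrite !(mf_sym dF (E ++ _)) [RHS](mf_sym dF).
have -> : d (E' ++ (b, y) :: o' ++ [:: (x, a)]) (E ++ (a, b) :: o) =
    d [:: (b, y), (x, a) & E' ++ o'] ((a, b) :: E ++ o).
  by apply: mf_perm2; perm_by_count.
have -> : d (E' ++ (a, y) :: o' ++ [:: (x, b)]) (E ++ (b, a) :: o) =
    - d [:: (b, x), (y, a) & E' ++ o'] ((a, b) :: E ++ o).
  rewrite (mf_flip dF b x) opprK; symmetry.
  have -> : d [:: (x, b), (y, a) & E' ++ o'] ((a, b) :: E ++ o) =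
      d [:: (y, a), (x, b) & E' ++ o'] ((a, b) :: E ++ o).
    by apply: mf_perm2; perm_by_count.
  rewrite (mf_flip dF y a) (mf_sym dF) (mf_flip dF a b) opprK (mf_sym dF).
  by apply: mf_perm2; perm_by_count.
rewrite (mf_plucker dF b y) addrK.
by apply: mf_perm2; perm_by_count.
Qed.

(** The alternating expression is a simple binomial relation.  With
    [P = ab.cv] and [Q = bc.av], one of the matchings of each of the four words
    contains [P] or [Q] up to sign.  Collecting the terms with the same one, the
    other matchings are summed by a Plucker relation, and the result is
    [d (Q, P.xy) - d (P, Q.xy)]. *)
Lemma word_trace_alt E a b c v Z :
  word_trace E [:: a, b, c, v & Z] - word_trace E [:: c, b, a, v & Z]
  - word_trace E [:: v, a, b, c & Z] + word_trace E [:: v, c, b, a & Z] = 0.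
Proof.
have [odd_w|] := boolP (odd (size Z)).
  by rewrite !word_trace_odd ?subr0 ?addr0 //= !negbK.
case/lastP: Z => [_|[|y Z] x] //=.
  rewrite (word_trace_rot1 E v [:: a; b; c]) (word_trace_rot1 E v [:: c; b; a]).
  by rewrite /= addrAC subrK subrr.
rewrite size_rcons /= negbK => even_Z.
set Z' := y :: rcons Z x.
rewrite /word_trace /Z' !rot1_cons !rcons_cons !alternate_cons2 -/Z'.
rewrite !alternate_rcons2 //.
set o := alternate Z'; set o' := alternate Z; set E' := map flip E.
pose P := [:: (a, b), (c, v) & E ++ o]; pose Q := [:: (b, c), (a, v) & E ++ o].
set R := E' ++ o'.
(* This Plucker relation sums two words whose first matchings both contain [P],
   or both contain [Q], up to sign. *)
have exch p q r e : d [:: (v, p), (x, q), r & R] e - d [:: (q, p), (x, v), r & R] e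
    = d [:: (v, q), (x, p), r & R] e.
  rewrite (mf_plucker dF v).
  have -> : d [:: (q, p), (x, v), r & R] e = d [:: (v, x), (p, q), r & R] e.
    rewrite (mf_flip dF) (mf_flip dF v).
    have -> : d [:: (p, q), (x, v), r & R] e = d [:: (x, v), (p, q), r & R] e.
      by apply: mf_perm2; perm_by_count.
    by [].
  by rewrite addrK.
have -> : d (E ++ [:: (a, b), (c, v) & o]) (E' ++ [:: (b, c), (v, y) & o' ++ [:: (x, a)]])
    = d [:: (v, y), (x, a), (b, c) & R] P.
  by rewrite (mf_sym dF); apply: mf_perm2; perm_by_count.
have -> : d (E ++ [:: (v, c), (b, a) & o]) (E' ++ [:: (c, b), (a, y) & o' ++ [:: (x, v)]])
    = - d [:: (a, y), (x, v), (b, c) & R] P.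
  have -> : d [:: (a, y), (x, v), (b, c) & R] P =
      d [:: (b, c), (a, y), (x, v) & R] P by apply: mf_perm2; perm_by_count.
  rewrite (mf_flip dF) opprK mf_flip_r.
  have -> : d [:: (c, b), (a, y), (x, v) & R] [:: (b, a), (c, v) & E ++ o] =
    d [:: (c, b), (a, y), (x, v) & R] [:: (c, v), (b, a) & E ++ o].
    by apply: mf_perm2; perm_by_count.
  rewrite mf_flip_r opprK (mf_sym dF); apply: mf_perm2; perm_by_count.
have -> : d (E ++ [:: (c, b), (a, v) & o]) (E' ++ [:: (b, a), (v, y) & o' ++ [:: (x, c)]])
    = d [:: (v, y), (x, c), (a, b) & R] Q.
  have -> : d [:: (v, y), (x, c), (a, b) & R] Q =
      d [:: (a, b), (v, y), (x, c) & R] Q by apply: mf_perm2; perm_by_count.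
  rewrite (mf_flip dF) mf_flip_r opprK (mf_sym dF).
  by apply: mf_perm2; perm_by_count.
have -> : d (E ++ [:: (v, a), (b, c) & o]) (E' ++ [:: (a, b), (c, y) & o' ++ [:: (x, v)]])
    = - d [:: (c, y), (x, v), (a, b) & R] Q.
  have -> : d [:: (c, y), (x, v), (a, b) & R] Q =
    d [:: (c, y), (x, v), (a, b) & R] [:: (a, v), (b, c) & E ++ o].
    by apply: mf_perm2; perm_by_count.
  rewrite mf_flip_r opprK (mf_sym dF).
  by apply: mf_perm2; perm_by_count.
rewrite opprK [LHS](ACl (1*4*(3*2)))/= exch -opprB exch.
have -> : d [:: (v, a), (x, y), (b, c) & R] P =
    - d P [:: (b, c), (a, v), (x, y) & R].
  rewrite (mf_flip dF) (mf_sym dF); congr (- _).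
  by apply: mf_perm2; perm_by_count.
rewrite (mf_binomial dF) (mf_flip dF v c) opprK addrC (mf_sym dF); apply/eqP.
by rewrite subr_eq0; apply/eqP/mf_perm2; perm_by_count.
Qed.

Lemma word_trace_like E :
  (forall x : W, x *+ 2 = 0 -> x = 0) -> trace_like (word_trace E).
Proof.
move=> W2; exact: (clifford_trace W2 word_trace_cyc word_trace_rev
  word_trace_clifford word_trace_alt).
Qed.
End WordTrace.

(** * Cycle decompositions of graphs of valence two *)

Section Cycles.
Context {L : finType}.
Implicit Types (a b c x y z : L) (p q r w : seq L) (l m : seq (L * L)).
Implicit Types (ws rest : seq (seq L)).

Fixpoint walk_edges a p : seq (L * L) :=
  if p is b :: p' then (a, b) :: walk_edges b p' else [::].

Definition cycle_edges w : seq (L * L) :=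
  if w is a :: p then walk_edges a (rcons p a) else [::].

Definition cycles_edges ws : seq (L * L) := flatten (map cycle_edges ws).

Lemma walk_edges_cat a p q :
  walk_edges a (p ++ q) = walk_edges a p ++ walk_edges (last a p) q.
Proof. by elim: p a => //= b p IH a; rewrite IH. Qed.

Lemma cycle_edges_cons a p :
  perm_eq (cycle_edges (a :: p)) ((last a p, a) :: walk_edges a p).
Proof. by rewrite /= -cats1 walk_edges_cat /= perm_catC. Qed.

Lemma cycle_edges_cat a p b q :
  perm_eq (cycle_edges ((a :: p) ++ b :: q))
    [:: (last a p, b), (last b q, a) & walk_edges a p ++ walk_edges b q].
Proof.
rewrite /= rcons_cat rcons_cons walk_edges_cat /= -cats1 walk_edges_cat /=.
perm_by_count.
Qed.

Lemma cycle_edges_rot u v : perm_eq (cycle_edges (u ++ v)) (cycle_edges (v ++ u)).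
Proof.
case: u => [|a p]; first by rewrite cats0.
case: v => [|b q]; first by rewrite cats0.
apply: perm_trans (cycle_edges_cat _ _ _ _) _.
rewrite perm_sym; apply: perm_trans (cycle_edges_cat _ _ _ _) _.
perm_by_count.
Qed.

Lemma rev_walk a p : rev (a :: p) = last a p :: rev (belast a p).
Proof. by rewrite lastI rev_rcons. Qed.

Lemma last_rev_walk a p : last (last a p) (rev (belast a p)) = a.
Proof. by case: p => //= b p; rewrite rev_cons last_rcons. Qed.

Lemma walk_edges_rev a p :
  perm_eq (walk_edges (last a p) (rev (belast a p))) (map flip (walk_edges a p)).
Proof.
elim: p a => //= b p IH a; rewrite rev_cons -cats1 walk_edges_cat /=.
rewrite last_rev_walk perm_catC /= perm_cons; exact: IH.
Qed.

Lemma cycle_edges_rev w :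
  perm_eq (cycle_edges (rev w)) (map flip (cycle_edges w)).
Proof.
case: w => // a p; rewrite rev_walk; apply: perm_trans (cycle_edges_cons _ _) _.
rewrite last_rev_walk perm_sym.
apply: perm_trans (perm_map _ (cycle_edges_cons _ _)) _.
by rewrite /= perm_cons perm_sym; apply: walk_edges_rev.
Qed.

Lemma size_walk_edges a p : size (walk_edges a p) = size p.
Proof. by elim: p a => //= b p IH a; rewrite IH. Qed.

Lemma size_cycle_edges w : size (cycle_edges w) = size w.
Proof. by case: w => // a p; rewrite /= size_walk_edges size_rcons. Qed.

Lemma walk_edgesP a b c p : (a, b) \in walk_edges c p ->
  exists q r, p = q ++ b :: r /\ last c q = a.
Proof.
elim: p c => //= d p IH c; rewrite inE => /orP[/eqP[-> ->]|/IH[q [r [-> <-]]]].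
  by exists [::], p.
by exists (d :: q), r.
Qed.

Lemma cycle_edgesP a b w : (a, b) \in cycle_edges w ->
  exists u v p, [/\ w = u ++ v, v ++ u = b :: p & last b p = a].
Proof.
case: w => // c p /walk_edgesP[q [r [E la]]].
case/lastP: r => [|r d] in E.
  move: E; rewrite cats1 => /rcons_inj[-> <-]; exists [::], (c :: q), q.
  by rewrite cats0.
move: E; rewrite -rcons_cons -rcons_cat => /rcons_inj[-> _].
exists (c :: q), (b :: r), (r ++ c :: q); split=> //.
by rewrite last_cat.
Qed.

(** The number of edges of [l] between [x] and [z] in either direction; loops are
    counted twice. *)
Definition umult l x z : nat := (count_mem (x, z) l + count_mem (z, x) l)%N.

Definition same_umult l m := forall x z, umult l x z = umult m x z.

Lemma umult_cat l m x z : umult (l ++ m) x z = (umult l x z + umult m x z)%N.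
Proof. by rewrite /umult !count_cat addnACA. Qed.

Lemma umult_cons e l x z :
  umult (e :: l) x z = ((e == (x, z)) + (e == (z, x)) + umult l x z)%N.
Proof. by rewrite /umult /= addnACA. Qed.

Lemma umult_perm l m : perm_eq l m -> same_umult l m.
Proof. by move=> /permP pe x z; rewrite /umult !pe. Qed.

Lemma umult_flip l : same_umult (map flip l) l.
Proof.
move=> x z; rewrite /umult addnC !count_map; congr (_ + _)%N; apply: eq_count.
  by case=> u v /=; rewrite /flip /= !xpair_eqE andbC.
by case=> u v /=; rewrite /flip /= !xpair_eqE andbC.
Qed.

(** The parity of the number of edges that go down for a fixed order of [L].  It
    turns the sign relation into the choice of a reference orientation. *)
Definition odd_descents l : bool :=
  odd (count (fun e => (enum_rank e.2 < enum_rank e.1)%N) l).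

Lemma odd_descents_cat l m : odd_descents (l ++ m) = odd_descents l (+) odd_descents m.
Proof. by rewrite /odd_descents count_cat oddD. Qed.

Lemma odd_descents_perm l m : perm_eq l m -> odd_descents l = odd_descents m.
Proof. by rewrite /odd_descents => /permP ->. Qed.

Lemma odd_descents_flip l : all (fun e => e.1 != e.2) l ->
  odd_descents (map flip l) = odd (size l) (+) odd_descents l.
Proof.
elim: l => //= -[x z] l IH /andP[/= xz /IH]; rewrite /odd_descents /= !oddD => ->.
have : enum_rank x != enum_rank z by rewrite (inj_eq enum_rank_inj).
rewrite -val_eqE /= !oddb.
by case: ltngtP => //= _ _; rewrite ?addbN ?addNb ?addFb ?negbK.
Qed.

Definition simple_cycles ws := uniq (flatten ws) && ([::] \notin ws).

Lemma cycles_edges_cat ws rest :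
  cycles_edges (ws ++ rest) = cycles_edges ws ++ cycles_edges rest.
Proof. by rewrite /cycles_edges map_cat flatten_cat. Qed.

Lemma cycles_edges_cons w rest :
  cycles_edges (w :: rest) = cycle_edges w ++ cycles_edges rest.
Proof. by []. Qed.

Lemma uniq_cycle_loopless w :
  uniq w -> size w != 1%N -> all (fun e => e.1 != e.2) (cycle_edges w).
Proof.
case: w => // a p; move=> /andP[ap up] sz.
rewrite (perm_all _ (cycle_edges_cons a p)) /=; apply/andP; split.
  case/lastP: p ap sz {up} => //= p b; rewrite last_rcons mem_rcons inE negb_or.
  by rewrite eq_sym => /andP[].
elim: p a ap up {sz} => //= b p IH a; rewrite inE negb_or => /andP[-> _].
by case/andP=> bp up; apply: IH.
Qed.

Section Uniqueness.
Context {W : zmodType}.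
Implicit Types (f : seq L -> W).

(** The product of traces after all edges are directed upwards; it depends only on
    the underlying undirected graph. *)
Definition cycles_value f ws : W :=
  sg (odd_descents (cycles_edges ws)) (multi_trace f ws).

Lemma cycles_value_front f w s1 s2 : trace_like f ->
  cycles_value f (s1 ++ w :: s2) = cycles_value f (w :: s1 ++ s2).
Proof.
move=> fT; rewrite /cycles_value multi_trace_front //; congr (sg _ _).
apply: odd_descents_perm; rewrite !cycles_edges_cat !cycles_edges_cons cycles_edges_cat.
perm_by_count.
Qed.

Lemma cycles_value_rot f u v ws : trace_like f ->
  cycles_value f ((u ++ v) :: ws) = cycles_value f ((v ++ u) :: ws).
Proof.
move=> fT; rewrite /cycles_value multi_trace_rot //; congr (sg _ _).
by apply: odd_descents_perm; rewrite !cycles_edges_cons perm_cat2r cycle_edges_rot.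
Qed.

Lemma cycles_value_rev f w ws : uniq w ->
  cycles_value f (rev w :: ws) = cycles_value f (w :: ws).
Proof.
move=> uw; have [|sz] := eqVneq (size w) 1%N; first by case: w uw => [|a []].
rewrite /cycles_value multi_trace_rev sg_sg; congr (sg _ _).
rewrite !cycles_edges_cons !odd_descents_cat (odd_descents_perm (cycle_edges_rev w)).
rewrite odd_descents_flip ?uniq_cycle_loopless // size_cycle_edges.
by rewrite addbC !addbA addbb.
Qed.

(** Rotation and reversal of a cycle and permutation of the cycles preserve the
    value, so any given edge of the graph can be made the closing edge of the
    first cycle. *)
Lemma cut_cycles a b ws : simple_cycles ws ->
  (0 < umult (cycles_edges ws) a b)%N ->
  exists p rest, [/\ last b p = a, perm_eq (flatten ((b :: p) :: rest)) (flatten ws),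
    simple_cycles ((b :: p) :: rest),
    same_umult (cycles_edges ((b :: p) :: rest)) (cycles_edges ws) &
    forall f, trace_like f -> cycles_value f ((b :: p) :: rest) = cycles_value f ws].
Proof.
move=> sws ab_ws.
have [w w_ws ab_w] : exists2 w, w \in ws & (a, b) \in cycle_edges w ++ map flip (cycle_edges w).
  have : (a, b) \in cycles_edges ws ++ map flip (cycles_edges ws).
    rewrite mem_cat; move: ab_ws; rewrite addn_gt0 -!has_count !has_pred1.
    case/orP=> [->//|ba_ws]; apply/orP; right.
    by apply/mapP; exists (b, a).
  rewrite mem_cat => /orP[/flattenP[e /mapP[w w_ws ->]] ab_w|].
    by exists w; rewrite // mem_cat ab_w.
  case/mapP=> -[b' a'] /flattenP[e /mapP[w w_ws ->]] ba_w [-> ->].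
  by exists w; rewrite // mem_cat; apply/orP; right; apply/mapP; exists (b', a').
case/splitPr: w_ws => s1 s2 in sws *.
have flat_w v : perm_eq v w -> perm_eq (flatten (v :: s1 ++ s2)) (flatten (s1 ++ w :: s2)).
  by move=> pvw; rewrite !flatten_cat /= perm_sym perm_catCA flatten_cat perm_cat2r perm_sym.
have uw : uniq w.
  case/andP: sws; rewrite -(perm_uniq (flat_w w (perm_refl _))) /=.
  by rewrite cat_uniq => /andP[].
have [w' [pw' ab_w' umult_w' val_w']] : exists w', [/\ perm_eq w' w,
    (a, b) \in cycle_edges w', same_umult (cycle_edges w') (cycle_edges w) &
    forall f, trace_like f -> cycles_value f (w' :: s1 ++ s2) = cycles_value f (w :: s1 ++ s2)].
  move: ab_w; rewrite mem_cat => /orP[ab_w|ab_w]; first by exists w.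
  exists (rev w); split=> [|||f fT]; last exact: cycles_value_rev.
  - by rewrite perm_rev.
  - by rewrite (perm_mem (cycle_edges_rev w)).
  - by move=> x z; rewrite (umult_perm (cycle_edges_rev w)) umult_flip.
have [u [v [p [Ew' Ep lp]]]] := cycle_edgesP ab_w'.
have flat_p : perm_eq (flatten ((b :: p) :: s1 ++ s2)) (flatten (s1 ++ w :: s2)).
  by apply: flat_w; rewrite -Ep perm_catC -Ew'.
exists p, (s1 ++ s2); split=> //.
- case/andP: sws => uws; rewrite mem_cat inE !negb_or => /and3P[n1 _ n2].
  by rewrite /simple_cycles (perm_uniq flat_p) uws inE mem_cat !negb_or n1.
- move=> x z; rewrite cycles_edges_cons !cycles_edges_cat cycles_edges_cons !umult_cat.
  by rewrite -Ep (umult_perm (cycle_edges_rot v u)) -Ew' umult_w' addnCA.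
- move=> f fT.
  by rewrite -Ep cycles_value_rot // -Ew' val_w' // cycles_value_front.
Qed.

Lemma umult_walk0 x b q z : x \notin b :: q -> umult (walk_edges b q) x z = 0%N.
Proof.
elim: q b => //= c q IH b; rewrite inE negb_or => /andP[xb xcq].
rewrite -cat1s umult_cat IH // /umult /= !xpair_eqE (eq_sym b) (negPf xb) /=.
by move: xcq; rewrite inE negb_or (eq_sym x c) => /andP[/negPf-> _]; rewrite andbF.
Qed.

Lemma umult_walk x b q z : x \notin b :: q ->
  umult (walk_edges x (b :: q)) x z = (b == z) :> nat.
Proof.
move=> xbq; rewrite /= -cat1s umult_cat umult_walk0 // /umult /= !xpair_eqE eqxx /=.
move: xbq; rewrite inE negb_or (eq_sym x b) => /andP[/negPf-> _].
by rewrite andbF !addn0.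
Qed.

Definition avoids m p := forall x z, x \in p -> umult m x z = 0%N.

(** A walk through vertices of valence two has no choice: the only edge that leaves
    [x] leads to the next letter. *)
Lemma walk_unique x a r r' m m' :
  uniq [:: x, a & r] -> uniq [:: x, a & r'] ->
  avoids m (x :: r) -> avoids m' (x :: r') ->
  same_umult (walk_edges x (rcons r a) ++ m) (walk_edges x (rcons r' a) ++ m') ->
  r = r' /\ same_umult m m'.
Proof.
have off p t : t \notin a :: p -> t \notin rcons p a by rewrite mem_rcons.
elim: r r' x => [|y r IH] [|y' r'] x /andP[xar uar] /andP[xar' uar'] mx mx' E.
- by split=> // u v; have := E u v; rewrite !umult_cat; lia.
- have := E x y'; rewrite !umult_cat mx ?mx' ?mem_head // !addn0.
  rewrite (umult_walk _ (off [::] _ xar)) (umult_walk _ (off _ _ xar')) eqxx.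
  by case: eqP => // ay; move: uar'; rewrite ay /= mem_head.
- have := E x y; rewrite !umult_cat mx ?mx' ?mem_head // !addn0.
  rewrite (umult_walk _ (off _ _ xar)) (umult_walk _ (off [::] _ xar')) eqxx.
  by case: eqP => // ay; move: uar; rewrite ay /= mem_head.
have Eyy : y = y'.
  have := E x y; rewrite !umult_cat mx ?mx' ?mem_head // !addn0.
  rewrite (umult_walk _ (off _ _ xar)) (umult_walk _ (off _ _ xar')) eqxx.
  by case: eqP.
have uar_y t s : uniq [:: a, t & s] -> uniq [:: t, a & s].
  by rewrite /= !inE !negb_or (eq_sym a) => /andP[/andP[-> ->] /andP[-> ->]].
subst y'; case: (IH r' y) => //; do ?exact: uar_y.
- by move=> t z tr; apply: mx; rewrite inE tr orbT.
- by move=> t z tr; apply: mx'; rewrite inE tr orbT.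
- by move=> u v; have := E u v; rewrite /= !(umult_cons (x, y)) => /addnI.
by move=> -> umult_mm'.
Qed.

Lemma umult_gt0 a b l : (a, b) \in l -> (0 < umult l a b)%N.
Proof. by move=> ab_l; rewrite addn_gt0 -has_count has_pred1 ab_l. Qed.

Lemma umult_cycles0 ws x z : x \notin flatten ws -> umult (cycles_edges ws) x z = 0%N.
Proof.
elim: ws => //= w ws IH; rewrite mem_cat negb_or => /andP[xw xws].
rewrite cycles_edges_cons umult_cat IH // addn0; case: w xw => // a p xap.
by rewrite /= umult_walk0 // inE mem_rcons !inE orbA orbb -in_cons.
Qed.

Lemma simple_cycles_cons w ws :
  simple_cycles (w :: ws) = [&& w != [::], uniq w, ~~ has (mem w) (flatten ws) & simple_cycles ws].
Proof.
rewrite /simple_cycles /= cat_uniq inE negb_or eq_sym.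
by case: (_ == _); case: (uniq w); case: (~~ has _ _); rewrite ?andbF ?andbT.
Qed.

(** Cut the second decomposition at the closing edge of the first cycle of the
    first one.  The two walks between the ends of this edge then agree, and the
    induction continues with the other cycles, for the function [symm f w], with [w]
    the common cycle. *)
Lemma cycles_value_unique f ws ws' : trace_like f ->
  simple_cycles ws -> simple_cycles ws' ->
  same_umult (cycles_edges ws) (cycles_edges ws') ->
  cycles_value f ws = cycles_value f ws'.
Proof.
elim: ws ws' f => [|w ws IH] ws' f fT sws sws' E.
  case: ws' => // -[|a p] ws' in sws' E *; first by move: sws'; rewrite simple_cycles_cons eqxx.
  have : (0 < umult (cycles_edges ((a :: p) :: ws')) (last a p) a)%N.
    by apply: umult_gt0; rewrite mem_cat (perm_mem (cycle_edges_cons a p)) mem_head.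
  by rewrite -E.
case: w sws E => [|a p] sws E; first by move: sws; rewrite simple_cycles_cons eqxx.
have E_pos : (0 < umult (cycles_edges ws') (last a p) a)%N.
  rewrite -E; apply: umult_gt0; rewrite mem_cat (perm_mem (cycle_edges_cons a p)).
  by rewrite mem_head.
have [p' [rest [lp' _ srest Erest <-//]]] := cut_cycles sws' E_pos.
have {E_pos Erest} {}E : same_umult (walk_edges a p ++ cycles_edges ws) (walk_edges a p' ++ cycles_edges rest).
  move=> x z; have := E x z; rewrite -Erest !cycles_edges_cons !umult_cat.
  rewrite !(umult_perm (cycle_edges_cons _ _)) lp' !(umult_cons (last a p, a)).
  by rewrite -!addnA => /addnI/addnI.
move: sws srest; rewrite !simple_cycles_cons.
move=> /and4P[_ up av sws] /and4P[_ up' av' srest].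
have [Ep {}E] : p = p' /\ same_umult (cycles_edges ws) (cycles_edges rest).
  case/lastP: p => [|r x] in up av lp' E *.
    case/lastP: p' => // r' x' in up' av' lp' E *.
    by move: up'; rewrite last_rcons /= in lp' *; rewrite lp' mem_rcons mem_head.
  rewrite last_rcons in lp'.
  case/lastP: p' => [|r' x'] in up' av' lp' E *.
    by move: up; rewrite -lp' /= mem_rcons mem_head.
  move: lp'; rewrite last_rcons => Ex; subst x'.
  have sh s : uniq (a :: rcons s x) -> uniq [:: a, x & s].
    by rewrite /= !mem_rcons rcons_uniq.
  have av_s s vs : ~~ has (mem (a :: rcons s x)) (flatten vs) -> avoids (cycles_edges vs) (a :: s).
    move=> nh t z ts; apply: umult_cycles0; apply: contra nh => t_vs.
    by apply/hasP; exists t => //=; rewrite -rcons_cons mem_rcons inE ts orbT.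
  by have [-> ?] := walk_unique (sh _ up) (sh _ up') (av_s _ _ av) (av_s _ _ av') E.
subst p'; rewrite /cycles_value !cycles_edges_cons !odd_descents_cat -!sg_sg; congr (sg _ _).
exact: (IH rest (symm f (a :: p)) (symm_trace fT _)).
Qed.
End Uniqueness.

(** * The value of a graph of valence two *)

Section CyclesFunctional.
Context {W : zmodType} (f : seq L -> W) (fT : trace_like f).

Definition decomposes ws l := simple_cycles ws /\ same_umult (cycles_edges ws) l.

(** The choice of a decomposition is immaterial by [cycles_value_unique]. *)
Definition graph_value l : W :=
  match pselect (exists ws, decomposes ws l) with
  | left ex => sg (odd_descents l) (cycles_value f (projT1 (cid ex)))
  | right _ => 0
  end.

Lemma graph_valueE ws l :
  decomposes ws l -> graph_value l = sg (odd_descents l) (cycles_value f ws).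
Proof.
move=> [sws Ews]; rewrite /graph_value; case: pselect => [ex|[]]; last by exists ws.
case: cid => ws' /= [sws' Ews']; congr (sg _ _); apply: cycles_value_unique => //.
by move=> x z; rewrite Ews Ews'.
Qed.

Lemma graph_value0 l : (forall ws, ~ decomposes ws l) -> graph_value l = 0.
Proof.
move=> no; rewrite /graph_value; case: pselect => // ex; exfalso.
by have [ws /no] := ex.
Qed.

Lemma graph_value_cycles ws : simple_cycles ws -> graph_value (cycles_edges ws) = multi_trace f ws.
Proof. by move=> sws; rewrite (@graph_valueE ws) // sgK. Qed.

Lemma graph_value_umult l m : same_umult l m -> graph_value l = sg (odd_descents l (+) odd_descents m) (graph_value m).
Proof.
move=> E; have [[ws dws]|no] := pselect (exists ws, decomposes ws l).
  have dws' : decomposes ws m by case: dws => s E'; split=> // x z; rewrite E'.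
  by rewrite (graph_valueE dws) (graph_valueE dws') sg_sg -addbA addbb addbF.
rewrite !graph_value0 ?sg0 // => ws [sws E']; apply: no; exists ws; split=> //.
by move=> x z; rewrite E'.
Qed.

Lemma graph_value_perm l m : perm_eq l m -> graph_value l = graph_value m.
Proof.
by move=> pe; rewrite (graph_value_umult (umult_perm pe)) (odd_descents_perm pe) addbb.
Qed.

Lemma graph_value_tail s l m : same_umult l m ->
  graph_value (s ++ l) = sg (odd_descents l (+) odd_descents m) (graph_value (s ++ m)).
Proof.
move=> E; rewrite (@graph_value_umult _ (s ++ m)).
  by rewrite !odd_descents_cat addbACA addbb.
by move=> x z; rewrite !umult_cat E.
Qed.

Lemma graph_value_loop a l : graph_value ((a, a) :: l) = 0.
Proof.
have [[ws dws]|no] := pselect (exists ws, decomposes ws ((a, a) :: l)); last first.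
  by apply: graph_value0 => ws dws; apply: no; exists ws.
rewrite (graph_valueE dws); case: dws => sws E.
have [|p [rest [lp _ srest _ <-//]]] := @cut_cycles W a a ws sws.
  by rewrite E umult_gt0 ?mem_head.
move: srest; rewrite simple_cycles_cons => /and4P[_ + _ _].
case/lastP: p lp => [_ _|p b]; first by rewrite /cycles_value (multi_trace_loop a [::]) // !sg0.
by rewrite last_rcons => ->; rewrite /= mem_rcons mem_head.
Qed.

Lemma graph_value_flip a b l : graph_value ((a, b) :: l) = - graph_value ((b, a) :: l).
Proof.
have [<-|ab] := eqVneq a b; first by rewrite !graph_value_loop oppr0.
have desc_ba : odd_descents [:: (b, a)] = ~~ odd_descents [:: (a, b)].
  by have := @odd_descents_flip [:: (a, b)]; rewrite /= ab => ->.
rewrite (@graph_value_umult _ ((b, a) :: l)).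
  by rewrite -cat1s -(cat1s (b, a)) !odd_descents_cat addbACA addbb addbF desc_ba addbN addbb.
move=> x z; rewrite !umult_cons !xpair_eqE; congr (_ + _)%N.
by rewrite addnC [(b == _) && _]andbC [(b == z) && _]andbC.
Qed.

Lemma graph_value_flips s l :
  graph_value (map flip s ++ l) = sg (odd (size s)) (graph_value (s ++ l)).
Proof.
elim: s l => //= -[a b] s IH l; rewrite (graph_value_flip b a) sg_negb; congr (- _).
have -> : graph_value ((a, b) :: map flip s ++ l) = graph_value (map flip s ++ (a, b) :: l).
  by apply: graph_value_perm; perm_by_count.
by rewrite IH; congr (sg _ _); apply: graph_value_perm; perm_by_count.
Qed.
Definition plucker_at a b c c' l : Prop :=
  graph_value [:: (a, b), (c, c') & l] =
  graph_value [:: (a, c'), (c, b) & l] + graph_value [:: (a, c), (b, c') & l].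

Lemma plucker_tail a b c c' l m : same_umult l m ->
  plucker_at a b c c' m -> plucker_at a b c c' l.
Proof.
rewrite /plucker_at => E plk; pose s x y z t := [:: (x, y); (z, t)] : seq (L * L).
rewrite -[[:: (a, b), _ & l]]/(s a b c c' ++ l) (graph_value_tail _ E) plk sgD.
by rewrite -!(graph_value_tail [:: _; _] E).
Qed.

Lemma merge_graph_value ws w w' rest : ws = [:: w, w' & rest] -> simple_cycles ws ->
  [/\ graph_value (cycles_edges ws) = multi_trace f ws,
     graph_value (cycles_edges ((w ++ w') :: rest)) = multi_trace f ((w ++ w') :: rest) &
     graph_value (cycles_edges ((w ++ rev w') :: rest)) = multi_trace f ((w ++ rev w') :: rest)].
Proof.
move=> -> sws; split; apply: graph_value_cycles => //.
  move: sws; rewrite /simple_cycles /= catA !inE !negb_or => /andP[-> /and3P[wn _ ->]].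
  by rewrite andbT; case: (w) wn.
move: sws; rewrite /simple_cycles /= catA !inE !negb_or => /andP[u /and3P[wn _ ->]].
rewrite (@perm_uniq _ _ ((w ++ w') ++ flatten rest)) ?u ?andbT; last first.
  by rewrite perm_cat2r perm_cat2l perm_rev.
by case: (w) wn.
Qed.
Lemma graph_value_perm2 e e' l : graph_value [:: e, e' & l] = graph_value [:: e', e & l].
Proof. by apply: graph_value_perm; perm_by_count. Qed.

(** The Plucker relation is alternating in its four vertices; this lemma and the
    next two treat three transpositions. *)
Lemma plucker_swap34 a b c c' l : plucker_at a b c' c l -> plucker_at a b c c' l.
Proof.
rewrite /plucker_at graph_value_perm2 (graph_value_flip c') graph_value_perm2 => E.
rewrite -[LHS]opprK E opprD addrC; congr (_ + _).
  by rewrite graph_value_perm2 graph_value_flip opprK graph_value_perm2.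
by rewrite graph_value_perm2 graph_value_flip opprK graph_value_perm2.
Qed.

Lemma plucker_swap23 a b c c' l : plucker_at a c b c' l -> plucker_at a b c c' l.
Proof.
rewrite /plucker_at => ->; rewrite addrA.
rewrite (graph_value_perm2 _ (c, b)) (graph_value_flip c b) (graph_value_perm2 (b, c)).
by rewrite addNr add0r.
Qed.

Lemma plucker_swap13 a b c c' l : plucker_at c b a c' l -> plucker_at a b c c' l.
Proof.
rewrite /plucker_at (graph_value_flip c a) => E.
rewrite (graph_value_perm2 (a, c')) E addrNK.
by rewrite graph_value_perm2.
Qed.

(** The closing edges of two cycles are replaced: the other two graphs are the two
    ways of joining the cycles, one of them with the second cycle reversed. *)
Lemma plucker_two_cycles b p c p' rest : simple_cycles [:: b :: p, c :: p' & rest] ->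
  plucker_at (last b p) b (last c p') c
    (walk_edges b p ++ walk_edges c p' ++ cycles_edges rest).
Proof.
set l := _ ++ _ ++ _ => sws; have [E2 E1 E3] := merge_graph_value (erefl _) sws.
have := multi_trace_merge (b :: p) (c :: p') rest fT.
rewrite -E1 -E2 -E3 /plucker_at => M.
have pc (q : L) (t : seq L) : perm_eq (cycle_edges (q :: t)) ((last q t, q) :: walk_edges q t).
  exact: cycle_edges_cons.
have -> : graph_value [:: (last b p, b), (last c p', c) & l] =
    graph_value (cycles_edges [:: b :: p, c :: p' & rest]).
  apply: graph_value_perm; rewrite !cycles_edges_cons perm_sym.
  apply: perm_trans (perm_cat (pc _ _) (perm_cat (pc _ _) (perm_refl _))) _.
  by rewrite /l; perm_by_count.
have -> : graph_value [:: (last b p, c), (last c p', b) & l] =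
    graph_value (cycles_edges (((b :: p) ++ c :: p') :: rest)).
  apply: graph_value_perm; rewrite !cycles_edges_cons perm_sym.
  apply: perm_trans (perm_cat (cycle_edges_cat _ _ _ _) (perm_refl _)) _.
  by rewrite /l; perm_by_count.
rewrite M -[LHS]addr0 -addrA; congr (_ + _); apply/esym/eqP.
rewrite addrC subr_eq0; apply/eqP.
have -> : graph_value (cycles_edges (((b :: p) ++ rev (c :: p')) :: rest)) =
    graph_value (map flip ((b, c) :: walk_edges c p') ++
      (last b p, last c p') :: walk_edges b p ++ cycles_edges rest).
  apply: graph_value_perm; rewrite !cycles_edges_cons rev_walk.
  apply: perm_trans (perm_cat (cycle_edges_cat _ _ _ _) (perm_refl _)) _.
  rewrite last_rev_walk; have /permP flipE := walk_edges_rev c p'.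
  apply/permP => P; rewrite !(count_cat, flipE) /= !count_cat !flipE [flip (b, c)]/flip /=; lia.
rewrite graph_value_flips /= size_walk_edges sgK.
by apply: graph_value_perm; rewrite /l; perm_by_count.
Qed.

(** Cut the graph at the edge [ab].  The edge [cc'] then closes another cycle, or
    it lies on the same cycle.  In the second case it splits this cycle into two
    words, and the relation is that of the two cycles made of them. *)
Lemma plucker_decomposes a b c c' l ws :
  decomposes ws [:: (a, b), (c, c') & l] -> plucker_at a b c c' l.
Proof.
case=> sws Ews; have [|p [rest [lp _ srest E _]]] := @cut_cycles W a b ws sws.
  by rewrite Ews umult_gt0 ?mem_head.
have {}E : same_umult ((c, c') :: l) (walk_edges b p ++ cycles_edges rest).
  move=> x z; have := E x z; rewrite Ews cycles_edges_cons umult_cat.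
  rewrite (umult_perm (cycle_edges_cons b p)) lp !(umult_cons (a, b)) umult_cat.
  by rewrite -!addnA => /addnI/addnI ->.
have : (0 < umult (walk_edges b p ++ cycles_edges rest) c c')%N.
  by rewrite -E umult_gt0 ?mem_head.
rewrite umult_cat addn_gt0 => /orP[in_walk|in_rest].
  have split_walk u v q r : p = q ++ v :: r -> last b q = u ->
      same_umult ((u, v) :: l) (walk_edges b p ++ cycles_edges rest) ->
      plucker_at a b u v l.
    move=> Ep lq E'; rewrite -lp -lq Ep last_cat /=; apply: plucker_swap13.
    apply: (@plucker_tail _ _ _ _ _ (walk_edges b q ++ walk_edges v r ++ cycles_edges rest)).
      move=> x z; have := E' x z.
      rewrite Ep walk_edges_cat /= lq !(umult_cons, umult_cat); lia.
    apply: plucker_two_cycles; move: srest.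
    by rewrite /simple_cycles Ep /= -catA !inE.
  have : (c, c') \in walk_edges b p ++ map flip (walk_edges b p).
    move: in_walk; rewrite mem_cat addn_gt0 -!has_count !has_pred1.
    case/orP=> [->//|ba_ws]; apply/orP; right.
    by apply/mapP; exists (c', c).
  rewrite mem_cat => /orP[/walk_edgesP[q [r [Ep lq]]]|]; first exact: split_walk Ep lq E.
  case/mapP=> -[u v] /walk_edgesP[q [r [Ep lq]]] [Ec Ec'].
  rewrite Ec Ec' in E *; apply: plucker_swap34; apply: (split_walk _ _ _ _ Ep lq).
  move=> x z; rewrite -E !umult_cons !xpair_eqE; congr (_ + _)%N.
  by rewrite addnC [(v == _) && _]andbC [(v == z) && _]andbC.
have srest' : simple_cycles rest.
  by move: srest; rewrite simple_cycles_cons => /and4P[].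
have [p' [rest' [lp' perm' srest'' E' _]]] := @cut_cycles W c c' rest srest' in_rest.
rewrite -lp -lp'.
apply: (@plucker_tail _ _ _ _ _ (walk_edges b p ++ walk_edges c' p' ++ cycles_edges rest')).
  move=> x z; have := E x z; have := E' x z.
  rewrite cycles_edges_cons !umult_cat (umult_perm (cycle_edges_cons c' p')) lp' !umult_cons; lia.
apply: plucker_two_cycles; move: srest srest''; rewrite /simple_cycles.
have -> : uniq (flatten [:: b :: p, c' :: p' & rest']) = uniq (flatten ((b :: p) :: rest)).
  by apply: perm_uniq; rewrite /= perm_cons perm_cat2l; exact: perm'.
by move=> /andP[-> _] /andP[_]; rewrite !inE.
Qed.

(** If one of the three graphs is a union of cycles, then it can play the role of
    the left side because the relation is alternating; otherwise all values are
    0. *)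
Lemma graph_value_plucker a b c c' l : plucker_at a b c c' l.
Proof.
have [[ws dws]|no] := pselect (exists ws, decomposes ws [:: (a, b), (c, c') & l]).
  exact: plucker_decomposes dws.
have [[ws dws]|no'] := pselect (exists ws, decomposes ws [:: (a, c), (b, c') & l]).
  exact/plucker_swap23/(plucker_decomposes dws).
have [[ws dws]|no''] := pselect (exists ws, decomposes ws [:: (a, c'), (c, b) & l]).
  apply/plucker_swap34/plucker_swap23/plucker_swap34.
  exact: (plucker_decomposes dws).
rewrite /plucker_at !graph_value0 ?addr0 //.
- by move=> ws dws; apply: no'; exists ws.
- by move=> ws dws; apply: no''; exists ws.
- by move=> ws dws; apply: no; exists ws.
Qed.
End CyclesFunctional.
End Cycles.

(** * Unions of two matchings *)

Section Matchings.
Context {L : finType} {W : zmodType} (d : seq (L * L) -> seq (L * L) -> W).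
Context (dF : matching_form d) (W2 : forall x : W, x *+ 2 = 0 -> x = 0).
Implicit Types (a b x y : L) (u w : seq L) (e g p q : seq (L * L)).

Definition ends e : seq L := flatten [seq [:: i.1; i.2] | i <- e].

Lemma ends_cat e g : ends (e ++ g) = ends e ++ ends g.
Proof. by rewrite /ends map_cat flatten_cat. Qed.

Lemma ends_cons a b e : ends ((a, b) :: e) = [:: a, b & ends e].
Proof. by []. Qed.

Lemma ends_perm e g : perm_eq e g -> perm_eq (ends e) (ends g).
Proof. by move=> pe; apply/perm_flatten/perm_map. Qed.

Lemma mem_ends x e : x \in ends e ->
  exists y e', perm_eq e ((x, y) :: e') \/ perm_eq e ((y, x) :: e').
Proof.
case/flattenP=> ? /mapP[[a b] ab_e ->]; rewrite !inE /=.
have pe := perm_to_rem ab_e.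
by case/orP=> /eqP ->; [exists b|exists a]; exists (rem (a, b) e); [left|right].
Qed.

Definition agree p q := graph_value (word_trace d [::]) (p ++ q) = d p q *+ 2.

Let fT := word_trace_like dF [::] W2.

Lemma agree_perm p p' q q' :
  perm_eq p p' -> perm_eq q q' -> agree p' q' -> agree p q.
Proof.
move=> pp qq; rewrite /agree (mf_perm2 dF pp qq) => <-.
by apply: graph_value_perm => //; apply: perm_cat.
Qed.

Lemma agree_flip_l a b p q : agree ((b, a) :: p) q -> agree ((a, b) :: p) q.
Proof.
rewrite /agree (mf_flip dF a b) /= => E; rewrite (graph_value_flip fT) E.
by rewrite mulNrn.
Qed.

Lemma agree_sym p q : agree q p -> agree p q.
Proof.
rewrite /agree (mf_sym dF) => <-; apply: graph_value_perm => //.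
by rewrite perm_catC.
Qed.

Lemma agree_flip_r a b p q : agree p ((b, a) :: q) -> agree p ((a, b) :: q).
Proof. by move=> /agree_sym/agree_flip_l/agree_sym. Qed.

Lemma agree_plucker a b c c' p q :
  agree p [:: (a, c'), (c, b) & q] -> agree p [:: (a, c), (b, c') & q] ->
  agree p [:: (a, b), (c, c') & q].
Proof.
move=> /agree_sym + /agree_sym; rewrite /agree => E1 E2.
apply: agree_sym; rewrite /agree /= (graph_value_plucker fT).
by rewrite -!cat_cons !cat_cons E1 E2 (mf_plucker dF a b) mulrnDl.
Qed.

Lemma walk_edges_alternate a w z : odd (size w) ->
  perm_eq (walk_edges a (rcons w z)) (alternate (a :: w) ++ alternate (rcons w z)).
Proof.
elim/seq2_ind: w a => // b c w IH a; rewrite /= negbK => odd_w.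
rewrite !alternate_cons2 /=.
apply: (@perm_trans _ [:: (a, b), (b, c) & alternate (c :: w) ++ alternate (rcons w z)]).
  by rewrite !perm_cons IH.
perm_by_count.
Qed.

Lemma agree_hamiltonian a w :
  odd (size w) -> uniq (a :: w) ->
  agree (alternate (a :: w)) (alternate (rcons w a)).
Proof.
move=> odd_w uw; rewrite -rot1_cons /agree.
have sw : simple_cycles [:: a :: w] by rewrite /simple_cycles [flatten _]cats0 uw.
have := graph_value_cycles fT sw; rewrite multi_trace1 // [cycles_edges _]cats0.
rewrite -[word_trace _ _ _]/(d (alternate (a :: w)) (alternate (rot 1 (a :: w)))).
move=> <-.
by apply: graph_value_perm; rewrite // rot1_cons perm_sym walk_edges_alternate.
Qed.

Lemma perm_front (T : eqType) (s t t' : seq T) c :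
  perm_eq t (c :: t') -> perm_eq (s ++ t) (c :: s ++ t').
Proof. by move=> pt; rewrite -cat1s perm_sym perm_catCA perm_cat2l perm_sym. Qed.

(** Follow the edges of the two matchings alternately along the path [a u x].  The
    edge of the second matching at [x] leads to a new edge of the first one, which
    extends the path, or it leads back to [a].  If it closes the cycle while there
    are other edges, then a Plucker relation with one of these replaces it
    by two matchings for both of which the path can be extended. *)
Lemma agree_path a n u x e g : (size e < n)%N -> ~~ odd (size u) ->
  uniq ([:: a, x & u] ++ ends e) -> perm_eq [:: a, x & ends e] (ends g) ->
  agree (alternate (a :: rcons u x) ++ e) (alternate u ++ g).
Proof.
elim: n u x e g => // n IH u x e g le_n even_u uniq_e perm_e.
have even_w : ~~ odd (size (a :: rcons u x)) by rewrite /= size_rcons /= negbK.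
have a_e : a \notin ends e.
  by move: uniq_e => /= /andP[+ _]; rewrite inE mem_cat !negb_or => /and3P[].
have extend y g' : y != a -> perm_eq (a :: ends e) (y :: ends g') ->
    agree (alternate (a :: rcons u x) ++ e) (alternate u ++ (x, y) :: g').
  move=> ya perm_g'.
  have : y \in a :: ends e by rewrite (perm_mem perm_g') mem_head.
  rewrite inE (negPf ya) => /mem_ends[y' [e' pe]].
  have [end_e sz_e] : perm_eq (ends e) [:: y, y' & ends e'] /\ size e = (size e').+1.
    case: pe => pe; rewrite (perm_size pe); split=> //.
      exact: (ends_perm pe).
    by apply: perm_trans (ends_perm pe) _; rewrite (perm_catCA [:: _] [:: _]).
  have main : agree (alternate (a :: rcons u x) ++ (y, y') :: e') (alternate u ++ (x, y) :: g').
    have -> : alternate (a :: rcons u x) ++ (y, y') :: e' =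
        alternate (a :: rcons (rcons (rcons u x) y) y') ++ e'.
      by rewrite -!rcons_cons alternate_rcons2 // -catA.
    have -> : alternate u ++ (x, y) :: g' = alternate (rcons (rcons u x) y) ++ g'.
      by rewrite alternate_rcons2 // -catA.
    apply: IH.
    - by rewrite -ltnS -sz_e.
    - by rewrite !size_rcons /= negbK.
    - rewrite (@perm_uniq _ _ ([:: a, x & u] ++ ends e)) //.
      by move/permP: end_e => Ee; apply/permP => P; rewrite !count_cat Ee -!cats1 /= !count_cat /=; clear; lia.
    - move/permP: end_e => Ee; move/permP: perm_g' => Eg; apply/permP => P.
      by move: (Ee P) (Eg P) => /=; clear; lia.
  case: pe => pe; first by apply: agree_perm main => //; rewrite perm_cat2l.
  apply: (@agree_perm _ ((y', y) :: alternate (a :: rcons u x) ++ e') _ (alternate u ++ (x, y) :: g')) => //.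
    exact: perm_front.
  by apply: agree_flip_l; apply: agree_perm main => //; perm_by_count.
have [y [g' [pg gE]]] : exists y g', perm_eq (a :: ends e) (y :: ends g') /\
    (agree (alternate (a :: rcons u x) ++ e) (alternate u ++ (x, y) :: g') ->
     agree (alternate (a :: rcons u x) ++ e) (alternate u ++ g)).
  have /mem_ends[y [g' pg]] : x \in ends g by rewrite -(perm_mem perm_e) !inE eqxx orbT.
  exists y, g'; split.
    have pg' : perm_eq (ends g) [:: x, y & ends g'].
      case: pg => /ends_perm //= pg; apply: perm_trans pg _.
      by rewrite (perm_catCA [:: _] [:: _]).
    move/permP: perm_e => E1; move/permP: pg' => E2; apply/permP => P.
    by move: (E1 P) (E2 P) => /=; clear; lia.
  case: pg => pg ag; first by apply: agree_perm ag => //; rewrite perm_cat2l.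
  apply: (@agree_perm _ (alternate (a :: rcons u x) ++ e) _ ((y, x) :: alternate u ++ g')) => //.
    exact: perm_front.
  by apply: agree_flip_r; apply: agree_perm ag => //; perm_by_count.
apply: gE; have [ya|] := eqVneq y a; last by move=> ya; apply: extend.
subst y; rewrite perm_cons in pg.
case: e => [|[s t] e] in le_n uniq_e perm_e a_e extend pg *.
  have -> : g' = [::] by case: (g') pg => // -[? ?] ? /perm_size.
  rewrite !cats0 cats1.
  have -> : rcons (alternate u) (x, a) = alternate (rcons (rcons u x) a).
    by rewrite alternate_rcons2 // cats1.
  apply: agree_hamiltonian; first by rewrite size_rcons.
  rewrite (@perm_uniq _ _ ([:: a, x & u] ++ [::])) // cats0 -cats1.
  by rewrite perm_cons perm_catC.
have [r [g'' [pg' ag]]] : exists r g'', perm_eq (ends ((s, t) :: e)) [:: s, r & ends g''] /\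
    (agree (alternate (a :: rcons u x) ++ (s, t) :: e) [:: (x, a), (s, r) & alternate u ++ g''] ->
     agree (alternate (a :: rcons u x) ++ (s, t) :: e) (alternate u ++ (x, a) :: g')).
  have /mem_ends[r [g'' pg']] : s \in ends g' by rewrite -(perm_mem pg) mem_head.
  exists r, g''; split.
    apply: perm_trans pg _; case: pg' => /ends_perm //= pg'.
    by apply: perm_trans pg' _; rewrite (perm_catCA [:: _] [:: _]).
  case: pg' => pg' ag.
    apply: agree_perm ag => //.
    apply: perm_trans (perm_front _ (perm_refl _)) _.
    by rewrite perm_cons; apply: perm_front.
  apply: (@agree_perm _ (alternate (a :: rcons u x) ++ (s, t) :: e) _ ((r, s) :: (x, a) :: alternate u ++ g'')) => //.
    apply: perm_trans (perm_front _ (perm_refl _)) _.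
    apply: (@perm_trans _ [:: (x, a), (r, s) & alternate u ++ g'']).
      by rewrite perm_cons; apply: perm_front.
    by perm_by_count.
  by apply: agree_flip_r; apply: agree_perm ag => //; perm_by_count.
have end_g : perm_eq [:: a, s, r & ends g''] (a :: ends ((s, t) :: e)).
  by rewrite perm_cons perm_sym.
(* The path closed too early: exchange the edge [xa] with another edge [sr]. *)
apply: ag; apply: agree_plucker.
  have ra : r != a.
    by apply: contraNneq a_e => <-; rewrite (perm_mem pg') !inE eqxx orbT.
  have ag : agree (alternate (a :: rcons u x) ++ (s, t) :: e)
      (alternate u ++ [:: (x, r), (s, a) & g'']).
    apply: extend ra _; rewrite perm_sym; apply: perm_trans end_g.
    by rewrite ends_cons; apply/permP => P /=; clear; lia.
  by apply: agree_perm ag => //; perm_by_count.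
have sa : s != a by apply: contraNneq a_e => <-; rewrite mem_head.
have ag : agree (alternate (a :: rcons u x) ++ (s, t) :: e)
    (alternate u ++ [:: (x, s), (a, r) & g'']).
  apply: extend sa _; rewrite perm_sym; apply: perm_trans end_g.
  by rewrite ends_cons; apply/permP => P /=; clear; lia.
by apply: agree_perm ag => //; perm_by_count.
Qed.

Lemma graph_value_matchings p q : uniq (ends p) -> perm_eq (ends p) (ends q) ->
  p <> [::] -> graph_value (word_trace d [::]) (p ++ q) = d p q *+ 2.
Proof.
case: p => [|[a x] p] // up pq _; apply: (@agree_path a (size p).+1 [::] x p q) => //.
Qed.
End Matchings.

(** * Edge lists and digraphs *)

Section EdgeLists.
Context {L : finType}.
Implicit Types (a b c x : L) (l e g : seq (L * L)).

Definition graph_of l : digraph L := \big[mmul/mone]_(p <- l) (ucm p : digraph L).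

Lemma graph_of_cons p l : graph_of (p :: l) = mmul (edge p.1 p.2) (graph_of l).
Proof. by case: p => a b; rewrite /graph_of big_cons. Qed.

Lemma graph_ofE l p : graph_of l p = count_mem p l.
Proof.
elim: l => [|q l IH]; first by rewrite /graph_of big_nil cm1.
by rewrite graph_of_cons cmM IH /edge cmU /=; case: q.
Qed.

Lemma digraph_eq (G H : digraph L) : (forall p, G p = H p) -> G = H.
Proof. by move=> E; apply/eqP/cmP. Qed.

Lemma graph_of_perm l l' : perm_eq l l' -> graph_of l = graph_of l'.
Proof. by move/permP=> E; apply: digraph_eq => p; rewrite !graph_ofE E. Qed.

Lemma graph_of_cat l l' : graph_of (l ++ l') = mmul (graph_of l) (graph_of l').
Proof. by apply: digraph_eq => p; rewrite cmM !graph_ofE count_cat. Qed.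

Lemma valence_graph_of l v : valence (graph_of l) v = count_mem v (ends l).
Proof.
elim: l => [|[a b] l IH].
  by rewrite /valence big1 // => w _; rewrite !graph_ofE.
rewrite graph_of_cons valenceM IH ends_cons /= addnA; congr (_ + _)%N.
rewrite /valence big_split /=; congr (_ + _)%N.
  rewrite (bigD1 b) //= big1 ?addn0 /edge ?cmU ?xpair_eqE ?eqxx ?andbT //.
  by move=> w /negPf wb; rewrite cmU xpair_eqE (eq_sym b) wb andbF.
rewrite (bigD1 a) //= big1 ?addn0 /edge ?cmU ?xpair_eqE ?eqxx //.
by move=> w /negPf wb; rewrite cmU xpair_eqE (eq_sym a) wb.
Qed.

Lemma regular_ends l : regular_of 1 (graph_of l) ->
  forall x, count_mem x (ends l) = 1%N.
Proof. by move=> /forallP reg x; rewrite -valence_graph_of; apply/eqP. Qed.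

Definition edges_of (G : digraph L) : seq (L * L) :=
  flatten [seq nseq (G p) p | p <- enum {: L * L}].

Lemma count_edges_of (G : digraph L) p : count_mem p (edges_of G) = G p.
Proof.
rewrite /edges_of count_flatten -map_comp sumnE big_map big_enum /=.
rewrite (bigD1 p) //= count_nseq /= eqxx mul1n big1 ?addn0 // => q qp.
by rewrite count_nseq /= (negPf qp).
Qed.

Lemma edges_ofK (G : digraph L) : graph_of (edges_of G) = G.
Proof. by apply: digraph_eq => p; rewrite graph_ofE count_edges_of. Qed.

Lemma edges_of_perm (G : digraph L) l :
  (forall p, G p = count_mem p l) -> perm_eq (edges_of G) l.
Proof. by move=> E; apply/allP => p _ /=; rewrite count_edges_of E. Qed.

Lemma graph_ofK l : perm_eq (edges_of (graph_of l)) l.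
Proof. by apply: edges_of_perm => p; rewrite graph_ofE. Qed.
End EdgeLists.

(** * Matchings in the ring of invariants *)

Section MatchingElements.
Context {L : finType}.
Implicit Types (a b c x : L) (l e g : seq (L * L)).

Lemma XG_relation (x : {malg int[regular_graph L]}) :
  graph_relation x -> \pi_(inv_ring L) x = 0.
Proof.
move=> /(@ideal_gen_gen _ (@graph_relation L)) x_rel.
have := Quotient.idealrBE (@graph_ideal L : idealr _) x 0.
by rewrite subr0 x_rel => /esym/eqP ->; rewrite raddf0.
Qed.

Lemma XG_sign a b H (G G' : regular_graph L) :
  val G = mmul (edge a b) H -> val G' = mmul (edge b a) H -> XG G = - XG G'.
Proof.
move=> EG EG'; apply/eqP; rewrite -addr_eq0 /XG -raddfD; apply/eqP/XG_relation.
by apply: Or32; exists a, b, H, G, G'.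
Qed.

Lemma XG_plucker a b c d H (G G' G'' : regular_graph L) :
  val G = mmul (mmul (edge a b) (edge c d)) H ->
  val G' = mmul (mmul (edge a d) (edge c b)) H ->
  val G'' = mmul (mmul (edge a c) (edge b d)) H -> XG G = XG G' + XG G''.
Proof.
move=> EG EG' EG''; apply/eqP; rewrite -subr_eq0 /XG -raddfD -raddfB; apply/eqP.
by apply/XG_relation/Or33; exists a, b, c, d, H, G, G', G''.
Qed.

Lemma regular_graph_of l : regular_of 1 (graph_of l) -> regular (graph_of l).
Proof. by move=> reg; apply/asboolP; exists 1%N. Qed.

Definition regular_of_list l (reg : regular_of 1 (graph_of l)) : regular_graph L :=
  exist _ (graph_of l) (regular_graph_of reg).

Lemma regular_graph_of_ends l l' : perm_eq (ends l) (ends l') ->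
  regular_of 1 (graph_of l) = regular_of 1 (graph_of l').
Proof.
move=> /permP pe; rewrite /regular_of; apply: eq_forallb => v.
by rewrite !valence_graph_of pe.
Qed.

Definition matching_elt l : VL L :=
  match boolP (regular_of 1 (graph_of l)) with
  | AltTrue reg => exist _ (XG (regular_of_list reg))
      (zspan_gen (ex_intro _ (regular_of_list reg) (conj reg erefl)))
  | AltFalse _ => 0
  end.

Lemma matching_eltT l (G : regular_graph L) :
  regular_of 1 (graph_of l) -> val G = graph_of l -> val (matching_elt l) = XG G.
Proof.
move=> reg EG; rewrite /matching_elt; case: {-}_ / boolP => [reg'|]; last by rewrite reg.
by congr XG; apply: val_inj.
Qed.

Lemma matching_eltF l : ~~ regular_of 1 (graph_of l) -> matching_elt l = 0.
Proof.
by move=> nreg; rewrite /matching_elt; case: {-}_ / boolP => // reg; rewrite reg in nreg.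
Qed.
Lemma matching_elt_perm l l' : perm_eq l l' -> matching_elt l = matching_elt l'.
Proof.
move=> pe; have E := graph_of_perm pe.
have [reg|nreg] := boolP (regular_of 1 (graph_of l)); last first.
  by rewrite !matching_eltF // -E.
apply: val_inj; rewrite (matching_eltT (G := regular_of_list reg)) //.
by rewrite (matching_eltT (G := regular_of_list reg)) -?E.
Qed.

Lemma matching_elt_loop a l : matching_elt ((a, a) :: l) = 0.
Proof.
apply: matching_eltF; apply/negP => /forallP/(_ a).
by rewrite valence_graph_of ends_cons /= eqxx.
Qed.

Lemma matching_elt_flip a b l :
  matching_elt ((a, b) :: l) = - matching_elt ((b, a) :: l).
Proof.
have pe : perm_eq (ends ((a, b) :: l)) (ends ((b, a) :: l)).
  by rewrite !ends_cons; apply/permP => P /=; lia.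
have [reg|nreg] := boolP (regular_of 1 (graph_of ((a, b) :: l))); last first.
  by rewrite !matching_eltF ?oppr0 -?(regular_graph_of_ends pe).
have reg' : regular_of 1 (graph_of ((b, a) :: l)) by rewrite -(regular_graph_of_ends pe).
apply: val_inj; rewrite raddfN /=.
rewrite (matching_eltT (G := regular_of_list reg)) //.
rewrite (matching_eltT (G := regular_of_list reg')) //.
by apply: (@XG_sign a b (graph_of l)); rewrite /= graph_of_cons.
Qed.

Lemma matching_elt_plucker a b c c' l :
  matching_elt [:: (a, b), (c, c') & l] =
  matching_elt [:: (a, c'), (c, b) & l] + matching_elt [:: (a, c), (b, c') & l].
Proof.
have pe : perm_eq (ends [:: (a, b), (c, c') & l]) (ends [:: (a, c'), (c, b) & l]).
  by rewrite !ends_cons; apply/permP => P /=; lia.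
have pe' : perm_eq (ends [:: (a, b), (c, c') & l]) (ends [:: (a, c), (b, c') & l]).
  by rewrite !ends_cons; apply/permP => P /=; lia.
have [reg|nreg] := boolP (regular_of 1 (graph_of [:: (a, b), (c, c') & l])); last first.
  by rewrite !matching_eltF ?addr0 -?(regular_graph_of_ends pe) -?(regular_graph_of_ends pe').
have reg1 : regular_of 1 (graph_of [:: (a, c'), (c, b) & l]).
  by rewrite -(regular_graph_of_ends pe).
have reg2 : regular_of 1 (graph_of [:: (a, c), (b, c') & l]).
  by rewrite -(regular_graph_of_ends pe').
apply: val_inj; rewrite raddfD /=.
rewrite (matching_eltT (G := regular_of_list reg)) //.
rewrite (matching_eltT (G := regular_of_list reg1)) //.
rewrite (matching_eltT (G := regular_of_list reg2)) //.
by apply: (@XG_plucker a b c c' (graph_of l)); rewrite /= !graph_of_cons mulmA.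
Qed.

Lemma val_VLD (u v : VL L) : val (u + v) = val u + val v.
Proof. by []. Qed.

Lemma val_VLMz (u : VL L) n : val (u *~ n) = val u *~ n.
Proof. exact: (raddfMz (val : {additive VL L -> inv_ring L})). Qed.

Lemma VL_ind (P : VL L -> Prop) :
  (forall u v, P u -> P v -> P (u + v)) -> (forall v, P v -> P (- v)) ->
  (forall l, regular_of 1 (graph_of l) -> P (matching_elt l)) -> P 0 -> forall v, P v.
Proof.
move=> PD PN Pm P0 v; have /asboolP[s [Ss Ev]] := valP v.
suff [t [Et Pt]] : exists t : VL L, val t = \sum_(p <- s) p.2 *~ p.1 /\ P t.
  by have -> : v = t by apply: val_inj; rewrite Et.
elim: s Ss {Ev} => [_|[n y] s IH Ss]; first by exists 0; rewrite big_nil.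
have [t [Et Pt]] : exists t : VL L, val t = \sum_(p <- s) p.2 *~ p.1 /\ P t.
  by apply: IH => p ps; apply: Ss; rewrite inE ps orbT.
have [G [regG /= ->]] := Ss _ (mem_head _ _).
have regE : regular_of 1 (graph_of (edges_of (val G))) by rewrite edges_ofK.
exists (matching_elt (edges_of (val G)) *~ n + t); split.
  rewrite big_cons val_VLD val_VLMz Et.
  by rewrite (matching_eltT regE (esym (edges_ofK _))).
apply: (PD) => //; have Pe := Pm _ regE.
have Pn k : P (matching_elt (edges_of (val G)) *+ k).
  by elim: k => // k IHk; rewrite mulrS; apply: PD.
by case: n {Ss} => n; rewrite ?NegzE ?mulrNz; [|apply: PN]; apply: Pn.
Qed.
End MatchingElements.

Lemma sym_genD (V : zmodType) (u v : V) : sym_gen (u + v) = sym_gen u + sym_gen v.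
Proof.
apply/eqP; rewrite -subr_eq0 opprD addrA /sym_gen -!raddfB; apply/eqP.
have rel : indet (u + v) - indet u - indet v \in (@sym_ideal V).
  by apply: ideal_gen_gen; exists u, v.
have := Quotient.idealrBE (@sym_ideal V : idealr _) (indet (u + v) - indet u - indet v) 0.
rewrite subr0 rel => /esym/eqP E; exact: etrans E (raddf0 \pi_(Sym V)).
Qed.

Lemma sym_gen_is_zmod_morphism (V : zmodType) : zmod_morphism (@sym_gen V).
Proof.
move=> u v; apply/eqP; rewrite eq_sym subr_eq; apply/eqP.
by rewrite -sym_genD subrK.
Qed.

HB.instance Definition _ (V : zmodType) :=
  GRing.isZmodMorphism.Build V (Sym V) (@sym_gen V) (@sym_gen_is_zmod_morphism V).

(** * The symmetric algebra modulo simple binomial relations *)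

Section SaturatedQuotient.
Context {L : finType}.
Implicit Types (a b c x : L) (l e g : seq (L * L)).

Definition binomial_element (s : Sym (VL L)) : Prop :=
  exists (U : {set L}) (G G' : matching (~: U)) (D D' : matching U),
    #|U| = 4%N /\ s = simple_binomial G G' D D'.

(** Closing the span under division by 2 makes the quotient free of 2-torsion, as
    the centrality argument requires, at the price of inverting 2 in the end. *)
Definition saturation : pred (Sym (VL L)) :=
  fun s => `[< exists k, s *+ (2 ^ k) \in zspan binomial_element >].

Lemma saturation_zmod_closed : zmod_closed saturation.
Proof.
split=> [|s t /asboolP[k sk] /asboolP[j tj]]; apply/asboolP.
  by exists 0%N; rewrite mul0rn rpred0.
exists (k + j)%N; rewrite mulrnBl expnD mulrnA [(2 ^ k * _)%N]mulnC (mulrnA t).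
by apply: rpredB; apply: rpredMn.
Qed.

HB.instance Definition _ :=
  GRing.isZmodClosed.Build (Sym (VL L)) saturation saturation_zmod_closed.

Definition sat_quotient := Quotient.quot (GRing.ZmodClosed.clone (Sym (VL L)) saturation _).
HB.instance Definition _ := GRing.Zmodule.on sat_quotient.

Definition to_quotient (s : Sym (VL L)) : sat_quotient := \pi_sat_quotient s.

Lemma to_quotient_is_zmod_morphism : zmod_morphism to_quotient.
Proof. by move=> s t; rewrite /to_quotient raddfB. Qed.

HB.instance Definition _ := GRing.isZmodMorphism.Build (Sym (VL L)) sat_quotient
  to_quotient to_quotient_is_zmod_morphism.

Lemma to_quotient_eq0 s : (to_quotient s == 0) = saturation s.
Proof.
have := Quotient.idealrBE (GRing.ZmodClosed.clone (Sym (VL L)) saturation _) s 0.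
rewrite subr0 => /esym E; apply: etrans E.
by congr (_ == _); rewrite raddf0.
Qed.

Lemma sat_quotient_2regular (x : sat_quotient) : x *+ 2 = 0 -> x = 0.
Proof.
rewrite -[x]reprK -/(to_quotient _) -raddfMn => /eqP; rewrite to_quotient_eq0.
move=> /asboolP[k sk]; apply/eqP; rewrite to_quotient_eq0; apply/asboolP.
by exists k.+1; rewrite expnS mulrnA.
Qed.

Definition pairing e g : sat_quotient :=
  to_quotient (sym_gen (matching_elt e) * sym_gen (matching_elt g)).
Lemma size_ends (T : finType) (l : seq (T * T)) : size (ends l) = (size l).*2.
Proof. by elim: l => // -[a b] l IH; rewrite ends_cons /= IH. Qed.

(** The four vertices of [p] are the set [U] of the relation. *)
Lemma simple_binomial_lists p q e g :
  size p = 2 -> perm_eq (ends p) (ends q) ->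
  regular_of 1 (graph_of (p ++ e)) -> regular_of 1 (graph_of (q ++ g)) ->
  binomial_element
    (sym_gen (matching_elt (p ++ e)) * sym_gen (matching_elt (q ++ g)) -
     sym_gen (matching_elt (q ++ e)) * sym_gen (matching_elt (p ++ g))).
Proof.
move=> sz_p pq reg_e reg_g; pose U := [set x in ends p].
have ce v : (count_mem v (ends p) + count_mem v (ends e) = 1)%N.
  by rewrite -(regular_ends reg_e v) ends_cat count_cat.
have cg v : (count_mem v (ends p) + count_mem v (ends g) = 1)%N.
  by rewrite -(regular_ends reg_g v) ends_cat count_cat (permP pq).
have inU v : (v \in U) = (0 < count_mem v (ends p))%N.
  by rewrite inE -has_count has_pred1.
have matchP (s : seq (L * L)) : perm_eq (ends p) (ends s) -> is_matching U (graph_of s).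
  move=> ps; apply/forallP => v; rewrite valence_graph_of -(permP ps) inU.
  by apply/eqP; have := ce v; lia.
have match_e : is_matching (~: U) (graph_of e).
  apply/forallP => v; rewrite valence_graph_of inE inU.
  by apply/eqP; have := ce v; lia.
have match_g : is_matching (~: U) (graph_of g).
  apply/forallP => v; rewrite valence_graph_of inE inU.
  by apply/eqP; have := cg v; lia.
pose M (s : seq (L * L)) (ps : perm_eq (ends p) (ends s)) : matching U :=
  exist _ (graph_of s) (matchP s ps).
pose Me : matching (~: U) := exist _ (graph_of e) match_e.
pose Mg : matching (~: U) := exist _ (graph_of g) match_g.
exists U, Me, Mg, (M p (perm_refl _)), (M q pq); split.
  rewrite cardsE (card_uniqP _).
    by rewrite size_ends sz_p.
  apply/count_mem_uniq => v; have := ce v; rewrite -has_pred1 has_count.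
  by case: (count_mem v (ends p)) => [|[]].
have XVE (s h : seq (L * L)) (ps : perm_eq (ends p) (ends s)) (H : matching (~: U)) :
    val H = graph_of h -> regular_of 1 (graph_of (s ++ h)) ->
    matching_elt (s ++ h) = XV H (M s ps).
  move=> EH reg; apply: val_inj; apply: matching_eltT => //=.
  by rewrite EH graph_of_cat mulmC.
have pe (h : seq (L * L)) : perm_eq (ends (p ++ h)) (ends (q ++ h)).
  by rewrite !ends_cat perm_cat2r.
have reg_e' : regular_of 1 (graph_of (q ++ e)) by rewrite -(regular_graph_of_ends (pe e)).
have reg_g' : regular_of 1 (graph_of (p ++ g)) by rewrite (regular_graph_of_ends (pe g)).
rewrite /simple_binomial /XS.
rewrite (XVE p e (perm_refl _) Me) // (XVE q g pq Mg) //.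
by rewrite (XVE q e pq Me) // (XVE p g (perm_refl _) Mg).
Qed.

Lemma pairing_form : matching_form pairing.
Proof.
have bin a b c c' e g :
    to_quotient (sym_gen (matching_elt [:: (a, b), (c, c') & e]) *
       sym_gen (matching_elt [:: (b, c), (a, c') & g])) =
    to_quotient (sym_gen (matching_elt [:: (b, c), (a, c') & e]) *
       sym_gen (matching_elt [:: (a, b), (c, c') & g])).
  have pq : perm_eq (ends [:: (a, b); (c, c')]) (ends [:: (b, c); (a, c')]).
    by rewrite !ends_cons; apply/permP => P /=; lia.
  have pe (h : seq (L * L)) : perm_eq (ends [:: (a, b), (c, c') & h])
      (ends [:: (b, c), (a, c') & h]).
    by rewrite !ends_cons; apply/permP => P /=; lia.
  have [reg_e|reg_e] := boolP (regular_of 1 (graph_of [:: (a, b), (c, c') & e])); last first.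
    rewrite (matching_eltF reg_e) (matching_eltF (l := [:: (b, c), (a, c') & e])).
      by rewrite !raddf0 !mul0r.
    by rewrite -(regular_graph_of_ends (pe e)).
  have [reg_g|reg_g] := boolP (regular_of 1 (graph_of [:: (b, c), (a, c') & g])); last first.
    rewrite (matching_eltF reg_g) (matching_eltF (l := [:: (a, b), (c, c') & g])).
      by rewrite !raddf0 !mulr0.
    by rewrite (regular_graph_of_ends (pe g)).
  apply/eqP; rewrite -subr_eq0 -raddfB to_quotient_eq0; apply/asboolP.
  exists 0%N; apply: zspan_gen.
  exact: (simple_binomial_lists (p := [:: (a, b); (c, c')]) _ pq reg_e reg_g).
split=> [e g|e e' g pe|a b e g|a e g|a b c c' e g|a b c c' e g]; rewrite /pairing.
- by rewrite mulrC.
- by rewrite (matching_elt_perm pe).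
- by rewrite matching_elt_flip raddfN mulNr raddfN.
- by rewrite matching_elt_loop raddf0 mul0r raddf0.
- by rewrite matching_elt_plucker raddfD mulrDl raddfD.
exact: bin.
Qed.
End SaturatedQuotient.

(** * The map back from the ring of invariants *)

Section InverseMap.
Context {L : finType}.
Implicit Types (a b c : L) (G H K : regular_graph L).
Local Notation graph_alg := {malg int[regular_graph L]}.
Implicit Types (x y : graph_alg).

Let W := @sat_quotient L.

Lemma pairing_trace : trace_like (word_trace (@pairing L) [::]).
Proof. exact: word_trace_like (@pairing_form L) [::] (@sat_quotient_2regular L). Qed.

Definition digraph_value (G : digraph L) : W :=
  graph_value (word_trace pairing [::]) (edges_of G).

Definition alg_value x : W := \sum_(G <- msupp x) digraph_value (val G) *~ x@_G.

Lemma alg_valueEw (D : {fset regular_graph L}) x : (msupp x `<=` D)%fset ->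
  alg_value x = \sum_(G <- D) digraph_value (val G) *~ x@_G.
Proof.
move=> le; rewrite /alg_value (big_fset_incl _ le) // => k _ /mcoeff_outdom ->.
by rewrite mulr0z.
Qed.

Lemma alg_value_is_zmod_morphism : zmod_morphism alg_value.
Proof.
move=> x y; rewrite (alg_valueEw (msuppB_le x y)).
rewrite (alg_valueEw (fsubsetUl (msupp x) (msupp y))).
rewrite (alg_valueEw (fsubsetUr (msupp x) (msupp y))).
by rewrite -sumrB; apply: eq_bigr => k _; rewrite mcoeffB mulrzBr.
Qed.

HB.instance Definition _ :=
  GRing.isZmodMorphism.Build graph_alg W alg_value alg_value_is_zmod_morphism.

Lemma alg_value_elt G : alg_value (graph_elt G) = digraph_value (val G).
Proof.
have le : (msupp (graph_elt G) `<=` [fset G])%fset.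
  by rewrite graph_elt.unlock; apply: msuppU_le.
by rewrite (alg_valueEw le) big_seq_fset1 graph_elt.unlock mcoeffUU.
Qed.

Lemma graph_eltM G H : graph_elt (mmul G H) = graph_elt G * graph_elt H.
Proof. by rewrite graph_elt.unlock malgM_def fgmulUU mulr1. Qed.

Lemma digraph_mulCA (A B C : digraph L) : mmul A (mmul B C) = mmul B (mmul A C).
Proof. by rewrite !mulmA (mulmC A). Qed.

Lemma edges_of_edge a b (H G : digraph L) : G = mmul (edge a b) H ->
  perm_eq (edges_of G) ((a, b) :: edges_of H).
Proof.
move=> ->; apply: edges_of_perm => p.
by rewrite cmM /edge cmU /= count_edges_of.
Qed.

Lemma digraph_value_plucker a b c c' (H G G' G'' : digraph L) :
  G = mmul (mmul (edge a b) (edge c c')) H ->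
  G' = mmul (mmul (edge a c') (edge c b)) H ->
  G'' = mmul (mmul (edge a c) (edge b c')) H ->
  digraph_value G = digraph_value G' + digraph_value G''.
Proof.
have edges2 s t u v (K : digraph L) : K = mmul (mmul (edge s t) (edge u v)) H ->
    perm_eq (edges_of K) [:: (s, t), (u, v) & edges_of H].
  rewrite -mulmA => /edges_of_edge/perm_trans; apply.
  by rewrite perm_cons; apply: edges_of_edge.
move=> /edges2 E /edges2 E' /edges2 E''; rewrite /digraph_value.
rewrite !(graph_value_perm pairing_trace E, graph_value_perm pairing_trace E').
rewrite (graph_value_perm pairing_trace E'').
exact: graph_value_plucker pairing_trace _ _ _ _ _.
Qed.

(** The product of a graph and a relation is a relation with more unchanged edges,
    so it is enough that graph values satisfy the relations. *)
Lemma alg_value_relation K x : graph_relation x -> alg_value (graph_elt K * x) = 0.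
Proof.
case=> [[a [G [/loop_edge[H EG] ->]]]|[a [b [H [G [G' [EG EG' ->]]]]]]|].
- rewrite -graph_eltM alg_value_elt /digraph_value.
  have /edges_of_edge pe : val (mmul K G) = mmul (edge a a) (mmul (val K) H).
    by rewrite /= EG digraph_mulCA.
  by rewrite (graph_value_perm pairing_trace pe) graph_value_loop //; apply: pairing_trace.
- rewrite mulrDr raddfD -!graph_eltM /= !alg_value_elt /digraph_value.
  have /edges_of_edge pe : val (mmul K G) = mmul (edge a b) (mmul (val K) H).
    by rewrite /= EG digraph_mulCA.
  have /edges_of_edge pe' : val (mmul K G') = mmul (edge b a) (mmul (val K) H).
    by rewrite /= EG' digraph_mulCA.
  rewrite (graph_value_perm pairing_trace pe) (graph_value_perm pairing_trace pe').
  by rewrite (graph_value_flip pairing_trace) addNr.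
case=> a [b [c [c' [H [G [G' [G'' [EG EG' EG'' ->]]]]]]]].
rewrite mulrBr mulrDr raddfB raddfD -!graph_eltM /= !alg_value_elt.
apply/eqP; rewrite subr_eq0; apply/eqP.
by apply: (@digraph_value_plucker a b c c' (mmul (val K) H));
  rewrite /= ?EG ?EG' ?EG'' digraph_mulCA.
Qed.

Lemma alg_value_ideal x : x \in @graph_ideal L -> alg_value x = 0.
Proof.
move=> /asboolP[s [rel ->]]; rewrite raddf_sum big_seq big1 // => -[y r] /rel /= r_rel.
rewrite (monalgE y) mulr_suml raddf_sum big1 // => K _.
have -> : << y@_K *g K >> = graph_elt K *~ y@_K.
  apply/malgP => G; apply: etrans (esym (raddfMz (mcoeff G) _ _)).
  have eG : (graph_elt K)@_G = (K == G)%:R by rewrite graph_elt.unlock mcoeffU.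
  apply: etrans (esym (congr1 (fun z => z *~ _) eG)).
  by rewrite mcoeffU; case: eqP => _; rewrite ?mul0rz ?intz.
by rewrite mulrzAl raddfMz /= alg_value_relation // mul0rz.
Qed.

Definition ring_value (y : inv_ring L) : W := alg_value (repr y).

Lemma ring_value_pi x : ring_value (\pi x) = alg_value x.
Proof.
apply/eqP; rewrite -subr_eq0 -raddfB; apply/eqP/alg_value_ideal.
by rewrite (Quotient.idealrBE (@graph_ideal L : idealr _)) reprK.
Qed.

Lemma ring_value_is_zmod_morphism : zmod_morphism ring_value.
Proof.
by move=> s t; rewrite -[s]reprK -[t]reprK -raddfB !ring_value_pi raddfB.
Qed.

HB.instance Definition _ :=
  GRing.isZmodMorphism.Build (inv_ring L) W ring_value ring_value_is_zmod_morphism.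

Lemma ring_value_graph G : ring_value (XG G) = digraph_value (val G).
Proof. by rewrite ring_value_pi alg_value_elt. Qed.
End InverseMap.

(** * Quadratic relations *)

Section QuadraticRelations.
Context {L : finType} (L_nonempty : (0 < #|L|)%N).
Implicit Types (l : seq (L * L)) (u v : VL L).

Lemma ring_value_matchings l l' :
  regular_of 1 (graph_of l) -> regular_of 1 (graph_of l') ->
  ring_value (val (matching_elt l) * val (matching_elt l')) = pairing l l' *+ 2.
Proof.
move=> reg reg'; have cl := regular_ends reg; have cl' := regular_ends reg'.
rewrite (matching_eltT (G := regular_of_list reg)) //.
rewrite (matching_eltT (G := regular_of_list reg')) // -XGM ring_value_graph.
rewrite /digraph_value /= -graph_of_cat.
rewrite (graph_value_perm pairing_trace (graph_ofK _)).
apply: (graph_value_matchings pairing_form (@sat_quotient_2regular L)).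
- apply: count_mem_uniq => x; rewrite cl; have := cl x.
  by case: (boolP (x \in ends l)) => // /count_memPn ->.
- by apply/allP => x _ /=; rewrite cl cl'.
- have [x _] := card_gt0P L_nonempty.
  by move=> l0; have := cl x; rewrite l0.
Qed.

(** Both sides are biadditive, so the claim reduces to matchings. *)
Lemma ring_value_mul u v :
  ring_value (val u * val v) = to_quotient (sym_gen u * sym_gen v) *+ 2.
Proof.
move: u; apply: VL_ind => [u u' Eu Eu'|u Eu|l reg|].
- by rewrite val_VLD mulrDl !raddfD mulrDl raddfD mulrnDl -Eu -Eu'.
- by rewrite !raddfN !mulNr !raddfN mulNrn -Eu.
- move: v; apply: VL_ind => [v v' Ev Ev'|v Ev|l' reg'|].
  + by rewrite val_VLD mulrDr !raddfD mulrDr raddfD mulrnDl -Ev -Ev'.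
  + by rewrite !raddfN !mulrN !raddfN mulNrn -Ev.
  + exact: ring_value_matchings.
  + by rewrite !raddf0 !mulr0 !raddf0 mul0rn.
- by rewrite !raddf0 !mul0r !raddf0 mul0rn.
Qed.

Lemma sym_to_ring_mul u v : sym_to_ring L (sym_gen u * sym_gen v) = val u * val v.
Proof.
apply: etrans (rmorphM (sym_to_ring L : {rmorphism _ -> _}) _ _) _.
by congr (_ * _); apply: (sym_lift_gen val).
Qed.

Definition defect (s : Sym (VL L)) : sat_quotient :=
  ring_value (sym_to_ring L s) - to_quotient s *+ 2.

Lemma defect_is_zmod_morphism : zmod_morphism defect.
Proof.
move=> s t; rewrite /defect.
have -> : sym_to_ring L (s - t) = sym_to_ring L s - sym_to_ring L t.
  exact: (rmorphB (sym_to_ring L : {rmorphism _ -> _})).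
by rewrite !raddfB mulrnBl /= !opprD addrACA.
Qed.

HB.instance Definition _ := GRing.isZmodMorphism.Build (Sym (VL L)) sat_quotient
  defect defect_is_zmod_morphism.

Lemma ring_value_quadratic s : s \in sym_degree (VL L) 2 ->
  ring_value (sym_to_ring L s) = to_quotient s *+ 2.
Proof.
move=> s2; apply/eqP; rewrite -subr_eq0 -/(defect s); apply/eqP.
apply: (zspan_ker (f := defect)) s2 => _ [v ->].
rewrite big_ord_recl big_ord1 /defect -[LHS]/(_ - _) sym_to_ring_mul ring_value_mul.
by rewrite subrr.
Qed.

Lemma quad_relation_saturated s :
  s \in quad_relation L -> exists k, s *+ (2 ^ k) \in zspan (@binomial_element L).
Proof.
move=> /andP[/eqP s0 s2]; suff /asboolP : saturation s by [].
rewrite -to_quotient_eq0; apply/eqP.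
by apply: sat_quotient_2regular; rewrite -ring_value_quadratic // s0 raddf0.
Qed.
End QuadraticRelations.

(** * Extension of scalars *)

Section TensorSpan.
Context (M : zmodType) (A : nzRingType).

Definition pure_left (a : A) (m : M) : tensor M A := pure m a.

Lemma pure_is_zmod_morphism_l (a : A) : zmod_morphism (pure_left a).
Proof.
rewrite /pure_left; by move=> u v; apply/eqP; rewrite eq_sym subr_eq -pureDl subrK.
Qed.

Lemma pure_is_zmod_morphism_r (m : M) : zmod_morphism (@pure M A m).
Proof.
by move=> u v; apply/eqP; rewrite eq_sym subr_eq -pureDr subrK.
Qed.

HB.instance Definition _ (a : A) :=
  GRing.isZmodMorphism.Build M (tensor M A) (pure_left a) (pure_is_zmod_morphism_l a).
HB.instance Definition _ (m : M) :=
  GRing.isZmodMorphism.Build A (tensor M A) (@pure M A m) (pure_is_zmod_morphism_r m).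

Lemma pureMn (m : M) (a : A) n : pure (m *+ n) a = pure m (a *+ n).
Proof.
by rewrite [RHS]raddfMn; apply: (raddfMn (pure_left a)).
Qed.

Lemma pureMz (m : M) (a : A) n : pure (m *~ n) a = a *~ n *: pure m 1.
Proof.
apply: etrans (raddfMz (pure_left a) _ _) _.
rewrite -[RHS]/(tensor_scale _ _) tensor_scaleE mulr1.
exact: esym (raddfMz (@pure M A m) _ _).
Qed.
End TensorSpan.

Lemma half_Zinv N : (0 < N)%N -> (2 %| N)%N -> exists h : Zinv N, h *+ 2 = 1.
Proof.
move=> N_gt0 /dvdnP[k EN].
have h2 : (2^-1 : rat) \in is_Zinv N.
  (* With [N = 2k], the value of [k X] at [1/N] is [1/2]. *)
  apply/asboolP; exists (k%:Z%:P * 'X).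
  rewrite rmorphM /= map_polyC map_polyX hornerM hornerC hornerX /=.
  have k_neq0 : k%:R != 0 :> rat.
    by rewrite Num.Theory.pnatr_eq0 -lt0n; move: N_gt0; rewrite EN muln_gt0 => /andP[].
  by rewrite EN natrM invfM mulrA divff // mul1r.
exists (exist _ 2^-1 h2); apply: val_inj; rewrite mulr2n.
have half2 : 2^-1 + 2^-1 = 1 :> rat by apply/eqP.
exact: half2.
Qed.

Section Main.
Context {L : finType} (L_nonempty : (0 < #|L|)%N) {N : nat}.
Context (half : Zinv N) (halfE : half *+ 2 = 1).

Definition simple_generator (s : tensor (I2 L) (Zinv N)) : Prop :=
  exists (U : {set L}) (G G' : matching (~: U)) (D D' : matching U),
         #|U| = 4%N /\ s = pure (simple_relation G G' D D') 1.

Lemma zspan_binomial_pure (m : I2 L) a :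
  val m \in zspan (@binomial_element L) -> lin_span *:%R simple_generator (pure m a).
Proof.
move=> /asboolP[s [bin Em]]; elim: s m bin Em => [|[n y] s IH] m bin Em.
  have -> : m = 0 by apply: val_inj; rewrite Em big_nil.
  have -> : pure (0 : I2 L) a = 0 by apply: (raddf0 (pure_left a)).
  exact: lin_span0.
have [U [G [G' [D [D' [U4 /= Ey]]]]]] := bin _ (mem_head _ _).
pose r := simple_relation G G' D D'.
have Emr : m = r *~ n + (m - r *~ n) by rewrite addrC subrK.
have -> : pure m a = pure (r *~ n) a + pure (m - r *~ n) a by rewrite -pureDl -Emr.
apply: lin_spanD.
  by rewrite pureMz; apply: lin_span_gen; exists U, G, G', D, D'.
apply: IH => [p ps|]; first by apply: bin; rewrite inE ps orbT.
have valB (u v : I2 L) : val (u - v) = val u - val v by [].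
have valMz (u : I2 L) k : val (u *~ k) = val u *~ k.
  exact: (raddfMz (val : {additive I2 L -> Sym (VL L)})).
by rewrite valB valMz Em big_cons /= Ey addrC addKr.
Qed.

Lemma pure_spanned (m : I2 L) a : lin_span *:%R simple_generator (pure m a).
Proof.
have [k mk] := quad_relation_saturated L_nonempty (valP m).
have halfX : half ^+ k *+ (2 ^ k) = 1.
  elim: k {mk} => // k IH.
  by rewrite exprS expnS mulrnA -mulrnAl halfE mul1r.
have -> : pure m a = pure (m *+ 2 ^ k) (a * half ^+ k).
  by rewrite pureMn -mulrnAr halfX mulr1.
apply: zspan_binomial_pure.
have -> // : val (m *+ 2 ^ k) = val m *+ 2 ^ k.
exact: (raddfMn (val : {additive I2 L -> Sym (VL L)})).
Qed.

Lemma tensor_spanned t : lin_span *:%R simple_generator t.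
Proof.
elim/tensor_ind: t => [m a|s t|s]; first exact: pure_spanned.
  exact: lin_spanD.
apply: (@lin_span_map _ _ _ _ -%R -%R); first exact: oppr0.
  exact: opprD.
by move=> r u; rewrite scaleNr.
Qed.
End Main.

Theorem theorem1p2 (L : finType) (L_nonempty : (0 < #|L|)%N)
    (L_even : ~~ odd #|L|) (t : tensor (I2 L) (Zinv 12`!)) :
  lin_span *:%R
    (fun s : tensor (I2 L) (Zinv 12`!) =>
       exists (U : {set L}) (G G' : matching (~: U)) (D D' : matching U),
         #|U| = 4%N /\ s = pure (simple_relation G G' D D') 1)
    t.
Proof.
have [half halfE] := half_Zinv (fact_gt0 12) (dvdn_fact (isT : 0 < 2 <= 12)%N).
exact: (tensor_spanned L_nonempty halfE).
Qed.
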